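(* Let $M$ be a smooth manifold such that the commutator subgroup $G:=[\pi_1(M), \pi_1(M)]$ of its fundamental group is finitely generated. Then the set $$\{ [\theta]\in H^1_{\mathrm{dR}}(M)\, |\, H^1_{\theta}(M)\neq 0\}$$ is finite and has at most $\mathrm{rank}(G)^{\mathrm{rank}(\pi_1(M))}$ elements.
   Context: For a closed $1$-form $\theta$ on $M$, the twisted differential is $d_\theta:=d-\theta\wedge\colon\Omega^k(M)\to\Omega^{k+1}(M)$; it satisfies $d_\theta\circ d_\theta=0$, and the twisted cohomology groups are $H^k_\theta(M):=\ker(d_\theta|_{\Omega^k(M)})/d_\theta(\Omega^{k-1}(M))$. These groups depend, up to canonical isomorphism, only on the de Rham class $[\theta]\in H^1_{\mathrm{dR}}(M)$, so the condition $H^1_\theta(M)\neq 0$ depends only on $[\theta]$. The rank of a group is the minimal number of elements in a generating set.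
   Formalization: The rank is the minimal size of a nonempty generating set, so the trivial group has rank 1 and the bound is 1 when G is trivial; with rank 0 the bound fails for the circle (0^1 = 0, but H^1 is nonzero for the class 0). M is assumed connected. *)

(* Defs.v *)
From HB Require Import structures.
From mathcomp Require Import all_boot all_order all_algebra all_fingroup.
From mathcomp Require Import generic_quotient.
From mathcomp Require Import all_classical all_reals all_analysis.
From mathcomp Require Import lra.

Set Implicit Arguments.
Unset Strict Implicit.
Unset Printing Implicit Defensive.

Import Order.TTheory GRing.Theory Num.Theory.
Import numFieldNormedType.Exports.

Local Open Scope classical_set_scope.
Local Open Scope ring_scope.
Local Open Scope quotient_scope.
Local Open Scope card_scope.

Section groups.
Context (gT : groupType).

Definition is_subgroup (H : set gT) : Prop :=
  [/\ H 1%g, (forall x y, H x -> H y -> H (x * y)%g) &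
      (forall x, H x -> H (x^-1)%g)].

Definition generated (A : set gT) : set gT := smallest is_subgroup A.

Definition commutator_subgroup : set gT :=
  generated [set z | exists x y : gT, z = [~ x, y]%g].

Definition finitely_generated (H : set gT) : Prop :=
  exists2 A : set gT, finite_set A & generated A = H.

(* Generating sets are nonempty, so that the rank of the trivial group is 1:
   were it 0, a bound rank(G) ^ rank(pi_1) would fail on the circle, where
   G = 1, rank(pi_1) = 1 and H^1 <> 0 for the zero class. *)
Definition generating_set (H A : set gT) : Prop := A !=set0 /\ generated A = H.

(* The rank is a possibly infinite cardinal: X is any type of that cardinality. *)
Definition has_rank (H : set gT) (X : Type) : Prop :=
  exists2 A, generating_set H A /\ A #= [set: X] &
             forall B, generating_set H B -> A #<= B.

End groups.

Arguments commutator_subgroup gT _ : clear implicits.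

Section within.
Context {X Y Z : topologicalType}.

Lemma within_comp (A : set X) (B : set Y) (g : X -> Y) (f : Y -> Z) :
  {within A, continuous g} -> g @` A `<=` B -> {within B, continuous f} ->
  {within A, continuous (f \o g)}.
Proof.
move=> /subspace_continuousP cg gAB /subspace_continuousP cf.
apply/subspace_continuousP => x Ax.
have cfx : f @ within B (nbhs (g x)) --> f (g x) by apply: cf; apply: gAB; exists x.
apply: cvg_trans cfx => U /= BU.
have := cg _ Ax _ BU; rewrite /within /nbhs /= => h.
by apply: filterS h => y + Ay; apply => //; apply: gAB; exists y.
Qed.

Lemma within_paste (A B : set X) (f g h : X -> Y) : closed A -> closed B ->
  {within A, continuous f} -> {within B, continuous g} ->
  (forall x, A x -> f x = h x) -> (forall x, B x -> g x = h x) ->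
  {within A `|` B, continuous h}.
Proof.
move=> cA cB cf cg fh gh; apply: withinU_continuous => //.
- by apply: subspace_eq_continuous cf => x /set_mem; exact: fh.
- by apply: subspace_eq_continuous cg => x /set_mem; exact: gh.
Qed.

End within.

Section fundamental_group.
Context (R : realType) (T : topologicalType) (x0 : T).

Record loop := Loop {
  loop_fun :> R -> T;
  loop_continuous : {within `[0, 1], continuous loop_fun};
  loop0 : loop_fun 0 = x0;
  loop1 : loop_fun 1 = x0 }.

HB.instance Definition _ := gen_eqMixin loop.
HB.instance Definition _ := gen_choiceMixin loop.

(* homotopy relative to the endpoints *)
Definition homotopic (f g : loop) : Prop := exists H : R * R -> T,
  [/\ {within `[0, 1] `*` `[0, 1], continuous H},
      {in `[0, 1], forall t, H (0, t) = f t /\ H (1, t) = g t} &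
      {in `[0, 1], forall s, H (s, 0) = x0 /\ H (s, 1) = x0}].

Let I : set R := `[0, 1].
Let IE (t : R) : I t <-> 0 <= t /\ t <= 1.
Proof. by rewrite /I /= in_itv /=; split => [/andP[]|[-> ->]]. Qed.
Let inIE (t : R) : t \in `[0, 1] = (0 <= t) && (t <= 1).
Proof. by rewrite in_itv. Qed.

Let cpair (X : topologicalType) (f g : X -> R) : continuous f -> continuous g ->
  continuous (fun x => (f x, g x)).
Proof. by move=> cf cg x; exact: (cvg_pair (cf x) (cg x)). Qed.

Let cadd (X : topologicalType) (f g : X -> R) : continuous f -> continuous g ->
  continuous (fun x => f x + g x).
Proof. by move=> cf cg x; exact: (cvgD (cf x) (cg x)). Qed.

Let csub (X : topologicalType) (f g : X -> R) : continuous f -> continuous g ->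
  continuous (fun x => f x - g x).
Proof. by move=> cf cg x; exact: (cvgB (cf x) (cg x)). Qed.

Let cmul (X : topologicalType) (f g : X -> R) : continuous f -> continuous g ->
  continuous (fun x => f x * g x).
Proof. by move=> cf cg x; exact: (cvgM (cf x) (cg x)). Qed.

Let ccst (X : topologicalType) (a : R) : continuous (fun _ : X => a).
Proof. by move=> x; exact: cvg_cst. Qed.

Let cid : continuous (fun x : R => x).
Proof. by move=> x; exact: cvg_id. Qed.

Let cfst : continuous (fun p : R * R => p.1).
Proof. by move=> p; exact: cvg_fst. Qed.

Let csnd : continuous (fun p : R * R => p.2).
Proof. by move=> p; exact: cvg_snd. Qed.

Let cmin (X : topologicalType) (f g : X -> R) : continuous f -> continuous g ->
  continuous (fun x => Num.min (f x) (g x)).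
Proof. by move=> cf cg x; exact: (@continuous_min _ _ f g x (cf x) (cg x)). Qed.

Let cmax (X : topologicalType) (f g : X -> R) : continuous f -> continuous g ->
  continuous (fun x => Num.max (f x) (g x)).
Proof. by move=> cf cg x; exact: (@continuous_max _ _ f g x (cf x) (cg x)). Qed.

Let closedle (X : topologicalType) (f g : X -> R) : continuous f ->
  continuous g -> closed [set x | f x <= g x].
Proof.
move=> cf cg.
rewrite (_ : [set _ | _] = (fun x => f x - g x) @^-1` [set y | y <= 0]).
  by apply: closed_comp; [move=> x _; exact: csub|exact: closed_le].
by apply/seteqP; split => x /=; rewrite subr_le0.
Qed.

Let clI2 : closed (I `*` I).
Proof.
rewrite (_ : I `*` I = ([set p | 0 <= p.1] `&` [set p | p.1 <= 1]) `&`
  ([set p | 0 <= p.2] `&` [set p | p.2 <= 1])); last first.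
  by apply/seteqP; split=> p /=; rewrite !IE => -[[] ? ? []].
by do ![apply: closedI]; apply: closedle => //; exact: ccst.
Qed.

(* pasting along a closed condition [f <= g] *)
Let wpaste (X Y : topologicalType) (C : set X) (u v : X -> R) (f g : X -> Y) :
  closed C -> continuous u -> continuous v ->
  {within C `&` [set x | u x <= v x], continuous f} ->
  {within C `&` [set x | v x <= u x], continuous g} ->
  (forall x, C x -> u x = v x -> f x = g x) ->
  {within C, continuous (fun x => if u x <= v x then f x else g x)}.
Proof.
move=> cC cu cv cf cg fg.
rewrite (_ : C = (C `&` [set x | u x <= v x]) `|` (C `&` [set x | v x <= u x])).
  apply: (within_paste _ _ cf cg).
  - by apply: closedI => //; exact: closedle.
  - by apply: closedI => //; exact: closedle.
  - by move=> x [_ /= ->].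
  - move=> x [Cx /= vu]; case: ifPn => // uv.
    by apply/esym/fg => //; apply/eqP; rewrite eq_le uv.
rewrite -setIUr; apply/esym/setIidl => x _ /=.
by have [|/ltW] := leP (u x) (v x); [left|right].
Qed.


Let wcomp (X Y Z : topologicalType) (A : set X) (B : set Y) (g : X -> Y)
    (f : Y -> Z) : continuous g -> (forall x, A x -> B (g x)) ->
  {within B, continuous f} -> {within A, continuous (fun x => f (g x))}.
Proof.
move=> cg gAB cf; apply: (@within_comp _ _ _ A B g f) => //.
- exact: continuous_subspaceT.
- by move=> _ [x Ax <-]; exact: gAB.
Qed.

Let loopI (f : loop) : {within I, continuous f}.
Proof. exact: loop_continuous. Qed.

(* two reparametrizations of the same loop by maps with equal endpoints *)
Let reparam (f g h : loop) (phi psi : R -> R) :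
  continuous phi -> continuous psi ->
  (forall t, I t -> I (phi t)) -> (forall t, I t -> I (psi t)) ->
  phi 0 = psi 0 -> phi 1 = psi 1 ->
  (forall t, I t -> f t = h (phi t)) -> (forall t, I t -> g t = h (psi t)) ->
  homotopic f g.
Proof.
move=> cphi cpsi Iphi Ipsi phi0 phi1 fE gE.
have I0 : I 0 by rewrite IE; lra.
have I1 : I 1 by rewrite IE; lra.
exists (fun p => h (phi p.2 + p.1 * (psi p.2 - phi p.2))); split.
- apply: (@wcomp _ _ _ _ I (fun p : R * R => phi p.2 + p.1 * (psi p.2 - phi p.2))).
  + have c1 : continuous (fun p : R * R => phi p.2).
      by move=> p; exact: (@continuous_comp _ _ _ snd phi p (@csnd p) (cphi p.2)).
    have c2 : continuous (fun p : R * R => psi p.2).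
      by move=> p; exact: (@continuous_comp _ _ _ snd psi p (@csnd p) (cpsi p.2)).
    by apply: cadd => //; apply: cmul => //; exact: csub.
  + move=> [s t] /= [/IE [s0 s1] It].
    have /IE[p0 p1] := Iphi _ It; have /IE[q0 q1] := Ipsi _ It.
    by apply/IE; split; nra.
  + exact: loopI.
- move=> t It; rewrite /= fE // gE //; split; congr (h _); lra.
- by move=> s _ /=; rewrite -phi0 -phi1 !subrr !mulr0 !addr0 -!fE ?loop0 ?loop1.
Qed.

Lemma homotopic_refl f : homotopic f f.
Proof.
by apply: (@reparam f f f id id) => //; exact: cid.
Qed.

Lemma homotopic_sym f g : homotopic f g -> homotopic g f.
Proof.
move=> [H [cH Hfg Hx]]; exists (fun p => H (1 - p.1, p.2)); split.
- apply: (@wcomp _ _ _ _ (I `*` I) (fun p : R * R => (1 - p.1, p.2))) => //.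
  + by apply: cpair => //; apply: csub => //; exact: ccst.
  + by move=> [s t] /= [/IE[s0 s1] It]; split => //=; apply/IE; lra.
- by move=> t /Hfg [h0 h1] /=; rewrite subrr subr0.
- move=> s; rewrite inIE => /andP[s0 s1] /=; apply: Hx.
  by rewrite inIE; apply/andP; lra.
Qed.

Lemma homotopic_trans f g h : homotopic f g -> homotopic g h -> homotopic f h.
Proof.
move=> [H [cH Hfg Hx]] [K [cK Kgh Kx]].
exists (fun p => if p.1 <= 2^-1 then H (2 * p.1, p.2) else K (2 * p.1 - 1, p.2)).
have c2 : continuous (fun p : R * R => 2 * p.1) by apply: cmul => //; exact: ccst.
split.
- apply: (@wpaste (R * R)%type _ (I `*` I) fst (cst 2^-1)
    (fun p => H (2 * p.1, p.2)) (fun p => K (2 * p.1 - 1, p.2))) => //.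
  + exact: ccst.
  + apply: (@wcomp _ _ _ _ (I `*` I) (fun p : R * R => (2 * p.1, p.2))) => //.
      exact: cpair.
    by move=> [s t] [[/= /IE[s0 s1] It] s2]; split => //=; apply/IE; lra.
  + apply: (@wcomp _ _ _ _ (I `*` I) (fun p : R * R => (2 * p.1 - 1, p.2))) => //.
      by apply: cpair => //; apply: csub => //; exact: ccst.
    by move=> [s t] [[/= /IE[s0 s1] It] s2]; split => //=; apply/IE; lra.
  + move=> [s t] [/= Is It] s2; rewrite s2 mulfV ?pnatr_eq0 // subrr.
    by have [_ ->] := Hfg t It; have [-> _] := Kgh t It.
- move=> t It /=; rewrite invr_ge0 ler0n mulr0; have [-> _] := Hfg t It.
  rewrite ifF; last by apply/negbTE; rewrite -ltNge; lra.
  by rewrite mulr1 (_ : 2 - 1 = 1); [have [_ ->] := Kgh t It|lra].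
- move=> s; rewrite inIE => /andP[s0 s1] /=; case: ifPn => [s2|].
    by apply: Hx; rewrite inIE; apply/andP; lra.
  by rewrite -ltNge => s2; apply: Kx; rewrite inIE; apply/andP; lra.
Qed.

Definition homotopicb (f g : loop) : bool := `[< homotopic f g >].

Let homotopicb_refl : reflexive homotopicb.
Proof. by move=> f; apply/asboolP/homotopic_refl. Qed.

Let homotopicb_sym : symmetric homotopicb.
Proof. by move=> f g; apply: asbool_equiv_eq; split; exact: homotopic_sym. Qed.

Let homotopicb_trans : transitive homotopicb.
Proof.
move=> g f h /asboolP fg /asboolP gh; apply/asboolP; exact: homotopic_trans fg gh.
Qed.

Definition homotopic_rel :=
  EquivRel homotopicb homotopicb_refl homotopicb_sym homotopicb_trans.

Definition pi1 := {eq_quot homotopic_rel}.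

HB.instance Definition _ := Choice.on pi1.
HB.instance Definition _ := Quotient.on pi1.

Lemma pi1P (f g : loop) : \pi_pi1 f = \pi_pi1 g <-> homotopic f g.
Proof. by split=> [/eqmodP/asboolP|fg] //; apply/eqmodP/asboolP. Qed.

Definition cst_loop : loop :=
  Loop (continuous_subspaceT (@cst_continuous R T x0)) erefl erefl.

Definition rev_fun (f : loop) (t : R) : T := f (1 - t).

Lemma rev_continuous f : {within `[0, 1], continuous (rev_fun f)}.
Proof.
rewrite /rev_fun; apply: (@wcomp R R T I I (fun t => 1 - t) f); last exact: loopI.
- by apply: csub => //; exact: ccst.
- by move=> t /IE[t0 t1]; apply/IE; lra.
Qed.

Lemma rev0 f : rev_fun f 0 = x0.
Proof. by rewrite /rev_fun subr0 loop1. Qed.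

Lemma rev1 f : rev_fun f 1 = x0.
Proof. by rewrite /rev_fun subrr loop0. Qed.

Definition rev_loop f : loop := Loop (@rev_continuous f) (rev0 f) (rev1 f).

Definition concat_fun (f g : loop) (t : R) : T :=
  if t <= 2^-1 then f (2 * t) else g (2 * t - 1).

Lemma concat_continuous f g : {within `[0, 1], continuous (concat_fun f g)}.
Proof.
have c2 : continuous (fun t : R => 2 * t) by apply: cmul => //; exact: ccst.
have clI : closed I.
  rewrite (_ : I = [set t | 0 <= t] `&` [set t | t <= 1]).
    by apply: closedI; apply: closedle => //; exact: ccst.
  by apply/seteqP; split=> t /=; rewrite IE.
apply: (@wpaste R _ I id (cst 2^-1) (fun t => f (2 * t)) (fun t => g (2 * t - 1))) => //.
- exact: ccst.
- apply: (@wcomp R R T _ I (fun t : R => 2 * t) f) => //.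
  by move=> t [/= /IE[t0 t1] t2]; apply/IE; lra.
- apply: (@wcomp R R T _ I (fun t : R => 2 * t - 1) g) => //.
  + by apply: csub => //; exact: ccst.
  + by move=> t [/= /IE[t0 t1] t2]; apply/IE; lra.
- by move=> t /= _ ->; rewrite mulfV ?pnatr_eq0 // subrr loop0 loop1.
Qed.

Lemma concat0 f g : concat_fun f g 0 = x0.
Proof. by rewrite /concat_fun invr_ge0 ler0n mulr0 loop0. Qed.

Lemma concat1 f g : concat_fun f g 1 = x0.
Proof.
rewrite /concat_fun ifF; last by apply/negbTE; rewrite -ltNge; lra.
by rewrite mulr1 (_ : 2 - 1 = 1); [rewrite loop1|lra].
Qed.

Definition concat_loop f g : loop :=
  Loop (@concat_continuous f g) (concat0 f g) (concat1 f g).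

Lemma homotopic_rev f g : homotopic f g -> homotopic (rev_loop f) (rev_loop g).
Proof.
move=> [H [cH Hfg Hx]]; exists (fun p => H (p.1, 1 - p.2)); split.
- apply: (@wcomp _ _ _ _ (I `*` I) (fun p : R * R => (p.1, 1 - p.2))) => //.
  + by apply: cpair => //; apply: csub => //; exact: ccst.
  + by move=> [s t] /= [Is /IE[t0 t1]]; split => //=; apply/IE; lra.
- by move=> t; rewrite inIE => t01 /=; apply: Hfg; rewrite inIE; lra.
- by move=> s /Hx[? ?] /=; rewrite subr0 subrr.
Qed.

Lemma homotopic_concat f f' g g' : homotopic f f' -> homotopic g g' ->
  homotopic (concat_loop f g) (concat_loop f' g').
Proof.
move=> [H [cH Hf Hx]] [K [cK Kg Kx]].
exists (fun p => if p.2 <= 2^-1 then H (p.1, 2 * p.2) else K (p.1, 2 * p.2 - 1)).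
have c2 : continuous (fun p : R * R => 2 * p.2) by apply: cmul => //; exact: ccst.
split.
- apply: (@wpaste (R * R)%type _ (I `*` I) snd (cst 2^-1)
    (fun p => H (p.1, 2 * p.2)) (fun p => K (p.1, 2 * p.2 - 1))) => //.
  + exact: ccst.
  + apply: (@wcomp _ _ _ _ (I `*` I) (fun p : R * R => (p.1, 2 * p.2))) => //.
      exact: cpair.
    by move=> [s t] [[/= Is /IE[t0 t1]] t2]; split => //=; apply/IE; lra.
  + apply: (@wcomp _ _ _ _ (I `*` I) (fun p : R * R => (p.1, 2 * p.2 - 1))) => //.
      by apply: cpair => //; apply: csub => //; exact: ccst.
    by move=> [s t] [[/= Is /IE[t0 t1]] t2]; split => //=; apply/IE; lra.
  + move=> [s t] [/= Is It] t2; rewrite t2 mulfV ?pnatr_eq0 // subrr.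
    by have [_ ->] := Hx s Is; have [-> _] := Kx s Is.
- move=> t; rewrite inIE => /andP[t0 t1] /=; rewrite /concat_fun; case: ifPn => [t2|].
    by apply: Hf; rewrite inIE; apply/andP; lra.
  by rewrite -ltNge => t2; apply: Kg; rewrite inIE; apply/andP; lra.
- move=> s Is /=; rewrite invr_ge0 ler0n mulr0; have [-> _] := Hx s Is.
  rewrite ifF; last by apply/negbTE; rewrite -ltNge; lra.
  by rewrite mulr1 (_ : 2 - 1 = 1); [have [_ ->] := Kx s Is|lra].
Qed.

Let cpl2 (X : topologicalType) (a : R) (f : X -> R) : continuous f ->
  continuous (fun x => a * f x).
Proof. by move=> cf; apply: cmul => //; exact: ccst. Qed.

Lemma concatA f g h : homotopic (concat_loop f (concat_loop g h))
                                (concat_loop (concat_loop f g) h).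
Proof.
apply: homotopic_sym.
apply: (@reparam _ _ (concat_loop f (concat_loop g h))
  (fun t => Num.min (2 * t) (Num.min (t + 4^-1) (2^-1 * t + 2^-1))) id) => //.
- apply: cmin; first exact: cpl2.
  by apply: cmin; apply: cadd; [exact: cid|exact: ccst|exact: cpl2|exact: ccst].
- by move=> t /IE[t0 t1]; apply/IE; rewrite /Num.min; do 2 case: ifPn; rewrite -?leNgt; lra.
- by rewrite /Num.min; do 2 case: ifPn; rewrite -?leNgt; lra.
- by rewrite /Num.min; do 2 case: ifPn; rewrite -?leNgt; lra.
- move=> t /IE[t0 t1] /=; rewrite /concat_fun /= /concat_fun.
  have [t4|t4] := leP t 4^-1.
    have -> : Num.min (2 * t) (Num.min (t + 4^-1) (2^-1 * t + 2^-1)) = 2 * t.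
      by rewrite /Num.min; do 2 case: ifPn; rewrite -?leNgt; lra.
    have -> : t <= 2^-1 by lra.
    by have -> : 2 * t <= 2^-1 by lra.
  have [t2|t2] := leP t 2^-1.
    have -> : Num.min (2 * t) (Num.min (t + 4^-1) (2^-1 * t + 2^-1)) = t + 4^-1.
      by rewrite /Num.min; do 2 case: ifPn; rewrite -?leNgt; lra.
    rewrite ifF; last by apply/negbTE; rewrite -ltNge; lra.
    rewrite ifF; last by apply/negbTE; rewrite -ltNge; lra.
    rewrite ifT; last by lra.
    by congr (g _); lra.
  have -> : Num.min (2 * t) (Num.min (t + 4^-1) (2^-1 * t + 2^-1)) = 2^-1 * t + 2^-1.
    by rewrite /Num.min; do 2 case: ifPn; rewrite -?leNgt; lra.
  rewrite ifF; last by apply/negbTE; rewrite -ltNge; lra.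
  rewrite ifF; last by apply/negbTE; rewrite -ltNge; lra.
  by congr (h _); lra.
Qed.

Lemma concat1l f : homotopic (concat_loop cst_loop f) f.
Proof.
apply: (@reparam _ _ f (fun t => Num.max 0 (2 * t - 1)) id) => //.
- apply: cmax; first exact: ccst.
  by apply: csub; [exact: cpl2|exact: ccst].
- by move=> t /IE[t0 t1]; apply/IE; rewrite /Num.max; case: ifPn; rewrite -?leNgt; lra.
- by rewrite /Num.max; case: ifPn; rewrite -?leNgt; lra.
- by rewrite /Num.max; case: ifPn; rewrite -?leNgt; lra.
- move=> t /IE[t0 t1] /=; rewrite /concat_fun /=; have [t2|t2] := leP t 2^-1.
    by rewrite max_l ?loop0 //; lra.
  by rewrite max_r //; lra.
Qed.

Lemma concat1r f : homotopic (concat_loop f cst_loop) f.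
Proof.
apply: (@reparam _ _ f (fun t => Num.min 1 (2 * t)) id) => //.
- by apply: cmin; [exact: ccst|exact: cpl2].
- by move=> t /IE[t0 t1]; apply/IE; rewrite /Num.min; case: ifPn; rewrite -?leNgt; lra.
- by rewrite /Num.min; case: ifPn; rewrite -?leNgt; lra.
- by rewrite /Num.min; case: ifPn; rewrite -?leNgt; lra.
- move=> t /IE[t0 t1] /=; rewrite /concat_fun /=; have [t2|t2] := leP t 2^-1.
    by rewrite min_r //; lra.
  by rewrite min_l ?loop1 //; lra.
Qed.

Lemma concatVr f : homotopic (concat_loop f (rev_loop f)) cst_loop.
Proof.
apply: (@reparam _ _ f (fun t => Num.min (2 * t) (2 - 2 * t)) (fun=> 0)) => //.
- by apply: cmin; [exact: cpl2|apply: csub; [exact: ccst|exact: cpl2]].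
- exact: ccst.
- by move=> t /IE[t0 t1]; apply/IE; rewrite /Num.min; case: ifPn; rewrite -?leNgt; lra.
- by move=> t _; apply/IE; lra.
- by rewrite /Num.min; case: ifPn; rewrite -?leNgt; lra.
- by rewrite /Num.min; case: ifPn; rewrite -?leNgt; lra.
- move=> t /IE[t0 t1] /=; rewrite /concat_fun /= /rev_fun; have [t2|t2] := leP t 2^-1.
    by rewrite min_l //; lra.
  by rewrite min_r; [congr (f _)|]; lra.
- by move=> t _; rewrite loop0.
Qed.

Lemma concatVl f : homotopic (concat_loop (rev_loop f) f) cst_loop.
Proof.
apply: (@reparam _ _ f (fun t => Num.max (1 - 2 * t) (2 * t - 1)) (fun=> 1)) => //.
- by apply: cmax; apply: csub; [exact: ccst|exact: cpl2|exact: cpl2|exact: ccst].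
- exact: ccst.
- by move=> t /IE[t0 t1]; apply/IE; rewrite /Num.max; case: ifPn; rewrite -?leNgt; lra.
- by move=> t _; apply/IE; lra.
- by rewrite /Num.max; case: ifPn; rewrite -?leNgt; lra.
- by rewrite /Num.max; case: ifPn; rewrite -?leNgt; lra.
- move=> t /IE[t0 t1] /=; rewrite /concat_fun /= /rev_fun; have [t2|t2] := leP t 2^-1.
    by rewrite max_l //; lra.
  by rewrite max_r //; lra.
- by move=> t _; rewrite loop1.
Qed.

Definition pi1_one : pi1 := \pi_pi1 cst_loop.
Definition pi1_inv (a : pi1) : pi1 := \pi_pi1 (rev_loop (repr a)).
Definition pi1_mul (a b : pi1) : pi1 := \pi_pi1 (concat_loop (repr a) (repr b)).

Let reprP f : homotopic (repr (\pi_pi1 f)) f.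
Proof. by apply/pi1P; rewrite reprK. Qed.

Lemma pi1_invE f : pi1_inv (\pi_pi1 f) = \pi_pi1 (rev_loop f).
Proof. by apply/pi1P/homotopic_rev. Qed.

Lemma pi1_mulE f g : pi1_mul (\pi_pi1 f) (\pi_pi1 g) = \pi_pi1 (concat_loop f g).
Proof. by apply/pi1P/homotopic_concat. Qed.

Lemma pi1_mulA : associative pi1_mul.
Proof.
elim/quotW => f; elim/quotW => g; elim/quotW => h.
rewrite (pi1_mulE g h) (pi1_mulE f g) (pi1_mulE f (concat_loop g h)).
rewrite (pi1_mulE (concat_loop f g) h); apply/pi1P; exact: concatA.
Qed.

Lemma pi1_mul1 : left_id pi1_one pi1_mul.
Proof. by elim/quotW => f; rewrite pi1_mulE; apply/pi1P/concat1l. Qed.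

Lemma pi1_mulr1 : right_id pi1_one pi1_mul.
Proof. by elim/quotW => f; rewrite pi1_mulE; apply/pi1P/concat1r. Qed.

Lemma pi1_mulV : left_inverse pi1_one pi1_inv pi1_mul.
Proof. by elim/quotW => f; rewrite pi1_invE pi1_mulE; apply/pi1P/concatVl. Qed.

Lemma pi1_mulrV : right_inverse pi1_one pi1_inv pi1_mul.
Proof. by elim/quotW => f; rewrite pi1_invE pi1_mulE; apply/pi1P/concatVr. Qed.

HB.instance Definition _ := isGroup.Build pi1
  pi1_mulA pi1_mul1 pi1_mulr1 pi1_mulV pi1_mulrV.

End fundamental_group.

Section smooth.
Context (R : realType) (n : nat).

Definition unitv (i : 'I_n) : 'rV[R]_n := delta_mx 0 i.

(* class C^m on U; only meaningful for U open *)
Fixpoint Cm_on (V : normedModType R) (m : nat) (U : set 'rV[R]_n)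
    (f : 'rV[R]_n -> V) : Prop :=
  (forall x, U x -> {for x, continuous f}) /\
  match m with
  | 0 => True
  | m'.+1 => forall i : 'I_n, (forall x, U x -> derivable f x (unitv i)) /\
                              Cm_on m' U ('D_(unitv i) f)
  end.

Definition smooth_on (V : normedModType R) (U : set 'rV[R]_n)
    (f : 'rV[R]_n -> V) : Prop := forall m, Cm_on m U f.

End smooth.

(* A smooth manifold of dimension n without boundary, given by an atlas that
   need not be maximal. [coord c] and [param c] are the mutually inverse maps
   between the chart domain and its image; their values elsewhere are junk. *)
Record smoothManifold (R : realType) (n : nat) := SmoothManifold {
  space :> topologicalType;
  chart : Type;
  chart_dom : chart -> set space;
  coord : chart -> space -> 'rV[R]_n;
  param : chart -> 'rV[R]_n -> space;
  space_hausdorff : hausdorff_space space;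
  space_second_countable : @second_countable space;
  chart_cover : forall p, exists c, chart_dom c p;
  chart_dom_open : forall c, open (chart_dom c);
  chart_image_open : forall c, open (coord c @` chart_dom c);
  coordK : forall c p, chart_dom c p -> param c (coord c p) = p;
  coord_continuous : forall c p, chart_dom c p -> {for p, continuous (coord c)};
  param_continuous : forall c x, (coord c @` chart_dom c) x ->
    {for x, continuous (param c)};
  transition_smooth : forall c c',
    smooth_on (coord c @` (chart_dom c `&` chart_dom c')) (coord c' \o param c) }.

Section forms.
Context (R : realType) (n : nat) (M : smoothManifold R n).

Definition chart_image (c : chart M) : set 'rV[R]_n := coord c @` chart_dom c.

(* The coefficients of a k-form: [w c J x] is the value of w on the coordinate
   fields d/dx_(J 0), ..., d/dx_(J (k-1)) of the chart c, at the point of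
   coordinates x. *)
Notation coefs k := (chart M -> {ffun 'I_k -> 'I_n} -> 'rV[R]_n -> R).

(* the differential k-forms; [form_out] fixes the values at x outside the chart,
   so that equality of coefficients is equality of forms *)
Record Omega (k : nat) (w : coefs k) : Prop := {
  form_smooth : forall c J, smooth_on (chart_image c) (w c J : _ -> R^o);
  form_out : forall c J x, ~ chart_image c x -> w c J x = 0;
  form_alternating : forall c (J : {ffun 'I_k -> 'I_n}) (s : 'S_k) x,
    w c [ffun i => J (s i)] x = (-1) ^+ s * w c J x;
  form_compatible : forall c c' (J : {ffun 'I_k -> 'I_n}) x,
    chart_image c x -> chart_dom c' (param c x) ->
    w c J x = \sum_(K : {ffun 'I_k -> 'I_n})
      (\prod_(i < k) ('D_(unitv R (J i)) (coord c' \o param c) x) 0 (K i)) *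
      w c' K (coord c' (param c x)) }.

Definition omit (k : nat) (J : {ffun 'I_k.+1 -> 'I_n}) (j : 'I_k.+1) :
  {ffun 'I_k -> 'I_n} := [ffun i => J (lift j i)].

Definition ext_d (k : nat) (w : coefs k) : coefs k.+1 := fun c J x =>
  if x \in chart_image c then
    \sum_(j < k.+1) (-1) ^+ j * 'D_(unitv R (J j)) (w c (omit J j) : _ -> R^o) x
  else 0.

(* the exterior product of a 1-form and a k-form *)
Definition wedge1 (k : nat) (t : coefs 1) (w : coefs k) : coefs k.+1 :=
  fun c J x => \sum_(j < k.+1)
    (-1) ^+ j * t c [ffun=> J j] x * w c (omit J j) x.

Definition twisted_d (t : coefs 1) (k : nat) (w : coefs k) : coefs k.+1 :=
  ext_d w - wedge1 t w.

Section cohomology.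
Variable d : forall k, coefs k -> coefs k.+1.

Definition cocycles (k : nat) : set (coefs k) := [set w | Omega w /\ d w = 0].

Definition coboundaries (k : nat) : set (coefs k) :=
  match k with
  | 0 => [set 0]
  | k'.+1 => @d k' @` @Omega k'
  end.

Definition coh_class (k : nat) (w : coefs k) : set (coefs k) :=
  [set w + b | b in @coboundaries k].

(* the quotient cocycles / coboundaries, as a set of cosets *)
Definition cohomology (k : nat) : set (set (coefs k)) :=
  @coh_class k @` @cocycles k.

Definition nontrivial_cohomology (k : nat) : Prop :=
  exists2 a, @cohomology k a & a <> coh_class (0 : coefs k).

End cohomology.

Definition closed_forms (k : nat) : set (coefs k) := @cocycles ext_d k.
Definition deRham_class (k : nat) (w : coefs k) : set (coefs k) :=
  coh_class ext_d w.

(* the classes [t] in H^1_dR(M) with H^1_t(M) <> 0 *)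
Definition twisted_classes : set (set (coefs 1)) :=
  [set deRham_class t | t in
    [set t | closed_forms t /\ nontrivial_cohomology (twisted_d t) 1]].

End forms.

Arguments twisted_classes {R n} M _.

(* Main.v *)
Require Import Defs.
From mathcomp Require Import all_boot all_order all_algebra all_fingroup.
From mathcomp Require Import all_classical all_reals all_analysis.
From mathcomp Require Import generic_quotient ring lra.

(* A pair of closed 1-forms (th, w), w being closed for d_th, defines a local system of
   solutions of dh - h th = w; locally a solution exists through every value (Poincare lemma) and
   is determined by it. Continuing solutions along loops gives an affine action
   v |-> v e^(p a) + u a of pi_1 on R, where p is the period homomorphism of th, and a fixed point
   of this action extends to a global solution, so that w is exact. In particular p determines
   [th]. If w is not exact and p <> 0, the restriction of u to G = [pi_1, pi_1] is a nonzero
   homomorphism to R which is an eigenvector, with character e^p, for the conjugation action of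
   pi_1. Eigenvectors with distinct characters are linearly independent, so, if G has r
   generators, there are at most r nonzero classes, hence at most r + 1 <= r ^ rank(pi_1) classes
   when r > 1, as pi_1 is then not cyclic. If G is cyclic, then e^p takes integral values, so
   p = 0. *)

Set Implicit Arguments.
Unset Strict Implicit.
Unset Printing Implicit Defensive.

Import Order.TTheory GRing.Theory Num.Theory.
Import numFieldNormedType.Exports.

Local Open Scope classical_set_scope.
Local Open Scope ring_scope.
Local Open Scope quotient_scope.
Local Open Scope card_scope.

(* mathcomp also has vector.coord and fingroup.generated. *)
Local Notation coord := Defs.coord.
Local Notation generated := Defs.generated.

(** * Calculus in R^n *)

(** Loops and homotopies are merely continuous, so a form cannot be integrated along them. The
    period is therefore obtained like everything else, by continuing solutions: it is the increment
    of a solution of dF = th, the equation with zero twist and right-hand side th. Continuation is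
    carried out for an abstract local system, which has to provide solutions through every value on
    small path-connected sets and to make the agreement of two solutions locally constant. Homotopy
    invariance then comes from continuing over the unit square. A linear relation between
    eigenvectors has to be tested on the r generators of G only, whereas G is stable under
    conjugation; a relation valid on G thus turns into one between the characters. The zero class
    escapes this argument and is counted apart. The resulting r + 1 is at most r ^ s only if both r
    and s are at least 2, and this is why cyclic G and cyclic pi_1 are treated separately. *)

Section lines.
Context (R : realType) (n : nat).
Notation E := 'rV[R]_n.
Implicit Types (x y a v : E).

Lemma is_derive_line (W : normedModType R) (f : E -> W) x v (s : R) :
  derivable f (x + s *: v) v ->
  is_derive s 1 (fun s : R => f (x + s *: v)) ('D_v f (x + s *: v)).
Proof.
have e : (fun h : R => h^-1 *: (((fun s : R => f (x + s *: v)) \o shift s) (h *: 1)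
      - f (x + s *: v))) =
    (fun h : R => h^-1 *: ((f \o shift (x + s *: v)) (h *: v) - f (x + s *: v))).
  apply/funext => h /=; congr (_ *: (f _ - _)).
  by rewrite [h *: 1]mulr1 scalerDl addrCA.
by move=> df; apply: DeriveDef; rewrite /derivable /derive e.
Qed.

Lemma growth_line (W : normedModType R) (f : E -> W) x v :
  (fun h : R => h^-1 *: (((fun s : R => f (x + s *: v)) \o shift 0) (h *: 1)
      - f (x + 0 *: v))) =
    (fun h : R => h^-1 *: ((f \o shift x) (h *: v) - f x)).
Proof.
by apply/funext => h /=; rewrite scale0r !addr0 [h *: 1]mulr1 [x + _]addrC.
Qed.

Lemma derivable_line (W : normedModType R) (f : E -> W) x v :
  derivable (fun s : R => f (x + s *: v)) 0 1 -> derivable f x v.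
Proof. by rewrite /derivable growth_line. Qed.

Lemma derive_line (W : normedModType R) (f : E -> W) x v :
  'D_v f x = 'D_1 (fun s : R => f (x + s *: v)) 0.
Proof. by rewrite /derive growth_line. Qed.

Lemma row_sum_unitv v : v = \sum_i v 0 i *: unitv R i.
Proof. exact: row_sum_delta. Qed.

Lemma diff_unitv (f : E -> R^o) x v : differentiable f x ->
  'd f x v = \sum_i v 0 i * 'D_(unitv R i) f x.
Proof.
move=> df; rewrite [in LHS](row_sum_unitv v) linear_sum; apply: eq_bigr => i _.
by rewrite linearZ deriveE.
Qed.

Lemma normr_entry v i : `|v 0 i| <= `|v|.
Proof.
rewrite [leRHS]mx_normrE; exact: (le_bigmax _ (fun i : 'I_1 * 'I_n => `|v i.1 i.2|) (0,i)).
Qed.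

Lemma norm_rV_lt v (e : R) : 0 < e -> (forall i, `|v 0 i| < e) -> `|v| < e.
Proof.
move=> e0 ve; rewrite [ltLHS]mx_normrE; apply: bigmax_lt => // -[j i] _ /=.
by rewrite (ord1 j).
Qed.

End lines.

Section mean_value.
Context (R : realType) (n : nat).
Notation E := 'rV[R]_n.
Implicit Types (x y a v : E).

Lemma MVT_line (g : E -> R^o) x v (e : R) :
  (forall s : R, 0 <= s <= 1 -> derivable g (x + s *: v) v) ->
  (forall s : R, 0 <= s <= 1 -> `|'D_v g (x + s *: v)| <= e) ->
  `|g (x + v) - g x| <= e.
Proof.
move=> dg ge; pose f (s : R) : R := g (x + s *: v).
have df (s : R) : 0 <= s <= 1 -> is_derive s 1 f ('D_v g (x + s *: v)).
  by move=> s01; apply: is_derive_line; exact: dg.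
have [| |c + +] := @MVT_segment R f (fun s => 'D_v g (x + s *: v)) 0 1 ler01.
- by move=> s; rewrite in_itv /= => /andP[/ltW ? /ltW ?]; apply: df; apply/andP.
- apply: derivable_within_continuous => s.
  by rewrite in_itv /= => s01; have [] := df s s01.
rewrite in_itv /= /f scale1r scale0r addr0 subr0 mulr1 => c01 ->.
exact: ge.
Qed.

(** Here f is only derivable along v. Composing the line through x with s |-> s * k reduces the
    claim to the chain rule in one variable. *)
Lemma derivableZv (W : normedModType R) (f : E -> W) x v (k : R) :
  derivable f x v -> is_derive x (k *: v) f (k *: 'D_v f x).
Proof.
have [->|k0] := eqVneq k 0.
  by move=> _; rewrite !scale0r; exact: is_derive0.
move=> df.
have h : is_derive (0 : R) 1 ((fun s : R => f (x + s *: v)) \o (fun s : R => s * k))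
    (k *: 'D_v f x).
  have df1 : differentiable (fun s : R => f (x + s *: v)) (0 * k).
    apply/derivable1_diffP; rewrite mul0r.
    have := @is_derive_line R n W f x v 0.
    by rewrite scale0r addr0 => /(_ df) [].
  have dk : differentiable (fun s : R => s * k) (0 : R).
    exact/derivable1_diffP.
  apply: DeriveDef; first by apply/derivable1_diffP; exact: differentiable_comp.
  rewrite deriveE; last exact: differentiable_comp.
  rewrite diff_comp //= -[X in 'd _ _ X]deriveE //.
  rewrite (_ : 'D_1 (fun s : R => s * k) 0 = k *: (1 : R)); last first.
    by rewrite deriveMr // derive_id.
  by rewrite linearZ /= -deriveE // mul0r -derive_line.
have e : (fun s : R => f (x + s *: v)) \o (fun s : R => s * k) =
    (fun s : R => f (x + s *: (k *: v))).
  by apply/funext => s /=; rewrite scalerA.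
rewrite e in h; case: h => h1 h2.
by apply: DeriveDef; [exact: derivable_line|rewrite derive_line].
Qed.

(* The line from x to x + h is replaced by a path parallel to the axes; it stays
   in the ball because balls are cubes. *)
Lemma partial_bound_lipschitz (g : E -> R^o) a (r e : R) :
  (forall y i, ball a r y -> derivable g y (unitv R i)) ->
  (forall y i, ball a r y -> `|'D_(unitv R i) g y| <= e) ->
  forall x h, ball a r x -> ball a r (x + h) -> `|g (x + h) - g x| <= n%:R * (e * `|h|).
Proof.
move=> dg ge x h ax ah.
(* The corners of the path: the first k coordinates of [z k] are already those of x + h. *)
pose z k : E := \row_i (if (i < k)%N then x 0 i + h 0 i else x 0 i).
have zE0 : z 0%N = x by apply/rowP => i; rewrite mxE ltn0.
have zEn : z n = x + h by apply/rowP => i; rewrite mxE ltn_ord mxE.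
have zS (k : 'I_n) : z k.+1 = z k + h 0 k *: unitv R k.
  apply/rowP => i; rewrite !mxE eqxx /= ltnS leq_eqVlt eq_sym.
  have [->|ik] := eqVneq i k; first by rewrite eqxx ltnn mulr1.
  by rewrite eq_sym val_eqE (negPf ik) mulr0 addr0.
have ba (k : 'I_n) (s : R) : 0 <= s <= 1 -> ball a r (z k + s *: (h 0 k *: unitv R k)).
  move=> /andP[s0 s1]; move: ax ah; rewrite -!ball_normE /= => ax ah.
  apply: norm_rV_lt => [|i]; first exact: le_lt_trans ax.
  have axi : `|a 0 i - x 0 i| < r.
    by apply: le_lt_trans ax; have := normr_entry (a - x) i; rewrite !mxE.
  have ahi : `|a 0 i - (x 0 i + h 0 i)| < r.
    by apply: le_lt_trans ah; have := normr_entry (a - (x + h)) i; rewrite !mxE.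
  rewrite !mxE eqxx /=; have [ik|ik] := eqVneq i k.
    rewrite ik in axi ahi *; rewrite ltnn mulr1.
    rewrite (_ : _ - _ = (1 - s) * (a 0 k - x 0 k) + s * (a 0 k - (x 0 k + h 0 k))); last ring.
    apply: le_lt_trans (ler_normD _ _) _; rewrite !normrM (ger0_norm s0).
    rewrite ger0_norm; last lra.
    by have [AB|/ltW AB] := leP `|a 0 k - x 0 k| `|a 0 k - (x 0 k + h 0 k)|; nra.
  by rewrite mulr0 mulr0 addr0; case: ifP.
rewrite -{1}zEn -{1}zE0 -(telescope_sumr (fun k => g (z k)) (leq0n n)) big_mkord.
apply: le_trans (ler_norm_sum _ _ _) _.
apply: le_trans (_ : \sum_(i < n) e * `|h| <= _); last first.
  by rewrite sumr_const card_ord mulr_natl.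
apply: ler_sum => k _; rewrite zS; apply: MVT_line => s s01.
  by have [] := @derivableZv _ g _ (unitv R k) (h 0 k) (dg _ k (ba k s s01)).
have [_ ->] := @derivableZv _ g _ (unitv R k) (h 0 k) (dg _ k (ba k s s01)).
rewrite [_ *: _]mulrC normrM ler_pM //; first exact/ge/ba.
exact: normr_entry.
Qed.

End mean_value.

Section partial_derivatives.
Context (R : realType) (n : nat).
Notation E := 'rV[R]_n.
Implicit Types (x y a v : E).

Lemma differentiable_coord_rV x i : differentiable (fun y : E => y 0 i : R^o) x.
Proof. exact: differentiable_coord. Qed.

Lemma derive_coord x i j : 'D_(unitv R j) (fun y : E => y 0 i : R^o) x = (i == j)%:R.
Proof.
rewrite derive_line (_ : (fun s : R => _) = (fun s : R => x 0 i + s * (i == j)%:R)).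
  rewrite deriveD // derive_cst add0r deriveMr // derive_id; exact: mulr1.
by apply/funext => s; rewrite !mxE eqxx.
Qed.

(** Subtracting the linear map L with the same partial derivatives at x leaves a function whose
    partial derivatives are small near x; the Lipschitz bound makes its increment o(h). *)
Lemma differentiable_of_partials (f : E -> R^o) x :
  (forall i, \forall y \near x, derivable f y (unitv R i)) ->
  (forall i, {for x, continuous ('D_(unitv R i) f)}) -> differentiable f x.
Proof.
move=> df cf; pose L y : R^o := \sum_i ('D_(unitv R i) f x) *: (y 0 i : R^o).
have dL y : differentiable L y.
  rewrite (_ : L = \sum_i ('D_(unitv R i) f x) *: (fun y : E => y 0 i : R^o)).
    by apply: differentiable_sum => i; exact/differentiableZ/differentiable_coord_rV.
  by apply/funext => z; rewrite fct_sumE.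
have DL y i : 'D_(unitv R i) L y = 'D_(unitv R i) f x.
  rewrite (_ : L = \sum_i ('D_(unitv R i) f x) *: (fun y : E => y 0 i : R^o)); last first.
    by apply/funext => z; rewrite fct_sumE.
  rewrite derive_sum; last first.
    by move=> j; apply/derivableZ/diff_derivable/differentiable_coord_rV.
  rewrite (bigD1 i) //= big1 => [|j ji].
    rewrite deriveZ; last exact/diff_derivable/differentiable_coord_rV.
    by rewrite derive_coord eqxx addr0; exact: mulr1.
  rewrite deriveZ; last exact/diff_derivable/differentiable_coord_rV.
  by rewrite derive_coord (negPf ji); exact: mulr0.
pose g : E -> R^o := f - L.
suff dg : differentiable g x.
  by rewrite (_ : f = g + L); [exact: differentiableD|rewrite /g subrK].
have go (e : R) : 0 < e ->
    \forall h \near (0 : E), `|(g \o shift x - (cst (g x) + \0)) h| <= e * `|h|.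
  (* The Lipschitz bound costs a factor n; dividing by n + 1 also covers n = 0. *)
  move=> e_gt0; have e0 : 0 < e / n.+1%:R by rewrite divr_gt0.
  have : \forall y \near x, forall i, derivable f y (unitv R i) /\
      `|'D_(unitv R i) f x - 'D_(unitv R i) f y| < e / n.+1%:R.
    apply: (@filter_forall _ 'I_n (fun i => [set y | derivable f y (unitv R i) /\ _]) (nbhs x)) => i.
    near=> y; split; first by near: y; exact: df.
    by near: y; move/cvgrPdist_lt: (cf i) => /(_ _ e0).
  move=> /nbhs_ballP[r /= r0 xr].
  apply/nbhs_ballP; exists r => //= h; rewrite -ball_normE /= sub0r normrN => hr.
  rewrite !fctE /= addr0 [h + x]addrC.
  apply: le_trans (_ : n%:R * (e / n.+1%:R * `|h|) <= _).
    apply: (@partial_bound_lipschitz R n g x r).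
    - move=> y i /xr/(_ i)[dfy _]; apply: derivableB => //; exact: diff_derivable.
    - move=> y i /xr/(_ i)[dfy ?]; rewrite deriveB ?DL //; last exact: diff_derivable.
      by rewrite distrC ltW.
    - exact: ballxx.
    - by rewrite -ball_normE /= opprD addNKr normrN.
  rewrite mulrA ler_wpM2r // mulrCA ler_piMr ?(ltW e_gt0) // ler_pdivrMr // mul1r ler_nat //.
have dg0 : 'd g x = \0%R :> (E -> R^o).
  apply: (@diff_unique R _ _ g \0%R x); first exact: cst_continuous.
  exact/eqaddoP.
apply/diff_locallyP; rewrite dg0; split; first exact: cst_continuous.
exact/eqaddoP.
Unshelve. all: by end_near. Qed.

Lemma zero_partials_cst (f : E -> R^o) a (r : R) :
  (forall y, ball a r y -> differentiable f y) ->
  (forall y i, ball a r y -> 'D_(unitv R i) f y = 0) ->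
  forall x y, ball a r x -> ball a r y -> f x = f y.
Proof.
move=> df Df x y xr yr; apply/eqP; rewrite -subr_eq0 -normr_le0.
have -> : x = y + (x - y) by rewrite subrKC.
apply: le_trans (@partial_bound_lipschitz R n f a r 0 _ _ y (x - y) yr _) _.
- by move=> z i zr; apply/diff_derivable/df.
- by move=> z i zr; rewrite Df // normr0.
- by rewrite subrKC.
- by rewrite mul0r mulr0.
Qed.

End partial_derivatives.

(** * The Poincare lemma on a ball *)

Section poincare.
Context (R : realType) (n : nat).
Notation E := 'rV[R]_n.
Implicit Types (x y a v : E).

Lemma near_bounded (I : finType) (f : I -> E -> R^o) a :
  (forall i, {for a, continuous (f i)}) ->
  \forall y \near a, forall i, `|f i y| <= \sum_i `|f i a| + 1.
Proof.
move=> cf; apply: (@filter_forall _ I (fun i => [set y | `|f i y| <= _]) (nbhs a)) => i.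
have := cf i; move/cvgrPdist_lt => /(_ 1 ltr01) h; near=> y => /=.
have : `|f i a - f i y| < 1 by near: y.
have : `|f i a| <= \sum_i `|f i a|.
  by rewrite (bigD1 i) //= lerDl sumr_ge0.
have := ler_normB (f i a) (f i a - f i y); rewrite subKr; lra.
Unshelve. all: by end_near. Qed.

Lemma continuous_sum_at (X : topologicalType) (f : 'I_n -> X -> R) (t : X) :
  (forall i, {for t, continuous (f i)}) -> {for t, continuous (fun z => \sum_i f i z)}.
Proof.
move=> cf; apply: (@cvg_big _ _ +%R 0) => [p|i _]; last exact: cf.
by apply: cvgD; [exact: cvg_fst|exact: cvg_snd].
Qed.

Lemma ball_segment a (r : R) y (t : R) : ball a r y -> 0 <= t <= 1 -> ball a r (a + t *: (y - a)).
Proof.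
rewrite -!ball_normE /= => yr /andP[t0 t1].
rewrite opprD addNKr normrN normrZ ger0_norm // distrC in yr *.
by apply: le_lt_trans yr; rewrite ler_piMl.
Qed.

Lemma continuous_line a v : continuous (fun t : R => a + t *: v).
Proof.
by move=> t; apply: cvgD; [exact: cvg_cst|apply: cvgZr_tmp; exact: cvg_id].
Qed.

Lemma near_line_ball a (r : R) x v : ball a r x ->
  exists2 d : R, 0 < d & forall s, s \in `](- d), d[ -> ball a r (x + s *: v).
Proof.
move=> xr; have : \forall s \near (0 : R), ball a r (x + s *: v).
  apply: (@continuous_line x v 0); rewrite scale0r addr0.
  by apply: open_nbhs_nbhs; split => //; exact: ball_open.
move=> /nbhs_ballP[d /= d0 dB]; exists d => // s; rewrite in_itv /= => /andP[s0 s1].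
by apply: dB; rewrite -ball_normE /= sub0r normrN ltr_norml s0.
Qed.

(** The pull-back of the 1-form w to the segment from a to x. Its integral is the usual radial
    primitive of a closed form. *)
Definition segment_integrand (w : 'I_n -> E -> R^o) a x (t : R) : R :=
  \sum_i w i (a + t *: (x - a)) * (x - a) 0 i.

Definition segment_primitive (w : 'I_n -> E -> R^o) a x : R^o :=
  (\int[@lebesgue_measure R]_(t in `[0%R, 1%R]) segment_integrand w a x t)%R.

Section primitive.
Variables (w : 'I_n -> E -> R^o) (a : E) (r C : R).
Hypotheses (r0 : 0 < r)
  (dw : forall i x, ball a r x -> differentiable (w i) x)
  (cw : forall i j x, ball a r x -> {for x, continuous ('D_(unitv R j) (w i))})
  (w_closed : forall i j x, ball a r x -> 'D_(unitv R j) (w i) x = 'D_(unitv R i) (w j) x)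
  (w_le : forall i x, ball a r x -> `|w i x| <= C)
  (Dw_le : forall i j x, ball a r x -> `|'D_(unitv R j) (w i) x| <= C).

Let is_derive_segment x j (s t : R) : ball a r (x + s *: unitv R j) -> 0 <= t <= 1 ->
  let p := a + t *: (x + s *: unitv R j - a) in
  is_derive s 1 (fun s => segment_integrand w a (x + s *: unitv R j) t : R^o)
    (\sum_i (w i p * (i == j)%:R +
      (x + s *: unitv R j - a) 0 i * (t * 'D_(unitv R j) (w i) p))).
Proof.
move=> xr t01 p.
rewrite /segment_integrand.
have -> : (fun s : R => \sum_i w i (a + t *: (x + s *: unitv R j - a)) *
     (x + s *: unitv R j - a) 0 i : R^o) = \sum_i (fun s : R =>
       w i (a + t *: (x - a) + s *: (t *: unitv R j)) * ((x - a) 0 i + s * (i == j)%:R) : R^o).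
  apply/funext => u; rewrite fct_sumE; apply: eq_bigr => i _; congr (w i _ * _).
    by apply/rowP => k; rewrite !mxE; ring.
  by rewrite !mxE eqxx addrAC.
apply: is_derive_sum => i.
have pE : p = a + t *: (x - a) + s *: (t *: unitv R j).
  by apply/rowP => k; rewrite !mxE; ring.
have pr : ball a r p by exact: ball_segment.
have h1 : is_derive s 1 (fun s : R => w i (a + t *: (x - a) + s *: (t *: unitv R j)))
    (t * 'D_(unitv R j) (w i) p).
  rewrite pE; apply: is_derive_eq; first by apply: is_derive_line; rewrite -pE; exact/diff_derivable/dw.
  by rewrite -pE !deriveE ?linearZ //; exact: dw.
have h2 : is_derive s 1 (fun s : R => (x - a) 0 i + s * (i == j)%:R : R^o) ((i == j)%:R : R).
  apply: is_derive_eq.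
  by rewrite add0r scaler0 add0r mul1r; exact: mulr1.
have := is_deriveM h1 h2; rewrite -pE => h3.
apply: is_derive_eq; rewrite /= !mxE eqxx /= addrAC //.
Qed.

(** By closedness this is also the derivative of the integrand in the direction j, as computed in
    [is_derive_segment]. Hence the integral of the latter over t is the increment of t * w j from 0
    to 1, that is [w j x]. *)
Let is_derive_tw x j (t : R) : ball a r x -> 0 <= t <= 1 ->
  let p := a + t *: (x - a) in
  is_derive t 1 (fun t : R => t * w j (a + t *: (x - a)))
    (\sum_i (w i p * (i == j)%:R + (x - a) 0 i * (t * 'D_(unitv R j) (w i) p))).
Proof.
move=> xr t01 p; have pr : ball a r p by exact: ball_segment.
have h : is_derive t 1 (fun t : R => w j (a + t *: (x - a))) ('D_(x - a) (w j) p).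
  by apply: is_derive_line; exact/diff_derivable/dw.
have := is_deriveM (is_derive_id t 1) h => {}h; apply: is_derive_eq.
rewrite big_split /= (bigD1 j) //= eqxx mulr1 big1 ?addr0 => [|i /negPf ->]; last exact: mulr0.
rewrite deriveE; last exact: dw.
rewrite diff_unitv; last exact: dw.
rewrite addrC -/p; congr (_ + _); last exact: mulr1.
rewrite [t *: _]mulr_sumr; apply: eq_bigr => i _.
by rewrite mulrCA w_closed.
Qed.

Let continuous_integrand_at x (t : R) : ball a r x -> 0 <= t <= 1 ->
  {for t, continuous (segment_integrand w a x)}.
Proof.
move=> xr t01; have pr := ball_segment xr t01.
rewrite /segment_integrand.
apply: (@continuous_sum_at R (fun i (t : R) => w i (a + t *: (x - a)) * (x - a) 0 i)) => i.
apply: cvgM; last exact: cvg_cst.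
apply: (@continuous_comp _ _ _ (fun t : R => a + t *: (x - a)) (w i)).
  exact: continuous_line.
by apply: differentiable_continuous; exact: dw.
Qed.

Let is_derive_primitive x j : ball a r x ->
  is_derive x (unitv R j) (segment_primitive w a) (w j x).
Proof.
move=> xr; have [d d0 xd] := near_line_ball (unitv R j) xr.
pose f (s t : R) : R := segment_integrand w a (x + s *: unitv R j) t.
have I01 t : (`[0%R, 1%R]%classic : set R) t -> 0 <= t <= 1 by rewrite /= in_itv.
have Id0 : (0 : R) \in `](- d), d[ by rewrite in_itv /= oppr_lt0 d0.
have fint s : s \in `](- d), d[ -> (@lebesgue_measure R).-integrable `[0%R, 1%R] (EFin \o f s).
  move=> sd; apply: continuous_compact_integrable; first exact: segment_compact.
  apply: continuous_in_subspaceT => t /set_mem /I01 t01.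
  by apply: continuous_integrand_at => //; exact: xd.
have df s t : s \in `](- d), d[ -> (`[0%R, 1%R]%classic : set R) t -> derivable (f ^~ t) s 1.
  by move=> sd /I01 t01; have [] := @is_derive_segment x j s t (xd s sd) t01.
(* A constant dominating function: in each summand [w i] and its partial derivatives are at most C,
   the entries of x + s *: unitv R j - a at most r, and t at most 1. *)
pose G : R -> R := cst (\sum_(i < n) (C + r * C)).
have C0 : 0 <= \sum_(i < n) (C + r * C).
  have C0 (i : 'I_n) : 0 <= C by apply: le_trans (w_le i xr).
  by apply: sumr_ge0 => i _; rewrite addr_ge0 ?mulr_ge0 ?(C0 i) // ltW.
have fG s t : s \in `](- d), d[ -> (`[0%R, 1%R]%classic : set R) t -> `|partial1of2 f s t| <= G t.
  move=> sd /I01 t01; rewrite partial1of2E.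
  have [_ ->] := @is_derive_segment x j s t (xd s sd) t01.
  have pr := ball_segment (xd s sd) t01.
  apply: le_trans (ler_norm_sum _ _ _) _; apply: ler_sum => i _.
  apply: le_trans (ler_normD _ _) _; apply: lerD.
    rewrite normrM; apply: le_trans (w_le i pr).
    by rewrite ler_piMr //; case: (i == j); rewrite /= ?normr1 ?normr0.
  rewrite !normrM; apply: ler_pM; rewrite ?mulr_ge0 ?normr_ge0 //.
    apply: le_trans (normr_entry _ _) _.
    by have := xd s sd; rewrite -ball_normE /= distrC => /ltW.
  move/andP: t01 => [t0 t1]; rewrite ger0_norm //.
  by apply: le_trans (Dw_le i j pr); rewrite ler_piMl.
have Gint : (@lebesgue_measure R).-integrable `[0%R, 1%R] (EFin \o G).
  apply: continuous_compact_integrable; first exact: segment_compact.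
  by apply: continuous_subspaceT => ?; exact: cvg_cst.
have mI : measurable (`[0%R, 1%R]%classic : set R) by exact: measurable_itv.
have FE : (fun s : R => segment_primitive w a (x + s *: unitv R j)) =
   (fun s : R => \int[@lebesgue_measure R]_(t in `[0%R, 1%R]) f s t)%R by [].
apply: DeriveDef.
  apply: derivable_line; rewrite FE.
  exact: (@derivable_under_integral R _ _ (@lebesgue_measure R) f _ mI 0 (- d) d Id0 fint df G (fun=> C0) Gint fG).
rewrite derive_line FE -derive1E.
rewrite (@differentiation_under_integral R _ _ (@lebesgue_measure R) f _ mI 0 (- d) d Id0 fint df G (fun=> C0) Gint fG).
pose g (t : R) : R := \sum_i (w i (a + t *: (x - a)) * (i == j)%:R +
  (x - a) 0 i * (t * 'D_(unitv R j) (w i) (a + t *: (x - a)))).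
pose h (t : R) : R := t * w j (a + t *: (x - a)).
have dh (t : R) : 0 <= t <= 1 -> is_derive t 1 h (g t) by exact: is_derive_tw.
have -> : w j x = fine ((h 1)%:E - (h 0)%:E)%E.
  by rewrite /h /= scale1r mul1r mul0r subr0 subrKC.
rewrite -(@continuous_FTC2 R g h 0 1) //.
- congr fine; apply: eq_integral => t /set_mem /I01 t01; congr EFin.
  rewrite partial1of2E.
  have [_ ->] := @is_derive_segment x j 0 t (xd 0 Id0) t01.
  by rewrite scale0r addr0.
- apply: continuous_in_subspaceT => t /set_mem /I01 t01.
  have pr := ball_segment xr t01.
  apply: (@continuous_sum_at R (fun i (t : R) => w i (a + t *: (x - a)) * (i == j)%:R +
    (x - a) 0 i * (t * 'D_(unitv R j) (w i) (a + t *: (x - a))))) => i.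
  apply: cvgD; apply: cvgM; [|exact: cvg_cst|exact: cvg_cst|apply: cvgM; first exact: cvg_id].
    apply: (@continuous_comp _ _ _ (fun t : R => a + t *: (x - a)) (w i)).
      exact: continuous_line.
    by apply: differentiable_continuous; exact: dw.
  apply: (@continuous_comp _ _ _ (fun t : R => a + t *: (x - a)) ('D_(unitv R j) (w i))).
    exact: continuous_line.
  exact: cw.
- have hc (t : R) : 0 <= t <= 1 -> {for t, continuous h}.
    by move=> /dh[+ _] => /derivable1_diffP/differentiable_continuous.
  split.
  + by move=> t; rewrite in_itv /= => /andP[/ltW t0 /ltW t1]; have [] := dh t; rewrite ?t0.
  + by apply: cvg_at_right_filter; apply: hc; rewrite lexx ler01.
  + by apply: cvg_at_left_filter; apply: hc; rewrite lexx ler01.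
- move=> t; rewrite in_itv /= => /andP[/ltW t0 /ltW t1].
  by have [|_ Dh] := dh t; rewrite ?t0 // derive1E.
Qed.

(** Differentiation under the integral gives one partial derivative at a time. They equal the [w i],
    which are continuous, and so total differentiability follows. *)
Lemma segment_primitiveP x : ball a r x ->
  differentiable (segment_primitive w a) x /\
  forall i, 'D_(unitv R i) (segment_primitive w a) x = w i x.
Proof.
move=> xr; split => [|i]; last by have [] := is_derive_primitive i xr.
have nr : \forall y \near x, ball a r y.
  by apply: open_nbhs_nbhs; split => //; exact: ball_open.
apply: differentiable_of_partials => i.
  by apply: filterS nr => y yr; have [] := is_derive_primitive i yr.
have [_ Dx] := is_derive_primitive i xr.
suff : 'D_(unitv R i) (segment_primitive w a) y @[y --> x] --> w i x by rewrite -Dx.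
apply: cvg_trans (differentiable_continuous (dw i xr)).
apply: (@near_eq_cvg _ _ (nbhs x)); near=> y; have yr : ball a r y by near: y.
by have [_ ->] := is_derive_primitive i yr.
Unshelve. all: by end_near. Qed.

End primitive.

(** The ball shrinks in order to bound w and its partial derivatives uniformly: by continuity they
    stay close to their values at the centre. *)
Lemma poincare (w : 'I_n -> E -> R^o) a (r : R) : 0 < r ->
  (forall i x, ball a r x -> differentiable (w i) x) ->
  (forall i j x, ball a r x -> {for x, continuous ('D_(unitv R j) (w i))}) ->
  (forall i j x, ball a r x -> 'D_(unitv R j) (w i) x = 'D_(unitv R i) (w j) x) ->
  exists2 s : R, 0 < s <= r & exists F : E -> R^o, forall x, ball a s x ->
    differentiable F x /\ forall i, 'D_(unitv R i) F x = w i x.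
Proof.
move=> r0 dw cw w_closed; have aa : ball a r a by exact: ballxx.
pose C1 : R := \sum_i `|w i a| + 1.
pose C2 : R := \sum_(ij : 'I_n * 'I_n) `|'D_(unitv R ij.2) (w ij.1) a| + 1.
have w_le : \forall y \near a, forall i, `|w i y| <= C1.
  by apply: near_bounded => i; exact/differentiable_continuous/dw.
have Dw_le : \forall y \near a, forall ij : 'I_n * 'I_n, `|'D_(unitv R ij.2) (w ij.1) y| <= C2.
  apply: (@near_bounded ('I_n * 'I_n)%type (fun ij => 'D_(unitv R ij.2) (w ij.1))) => ij.
  exact: cw.
have : \forall y \near a, (forall i, `|w i y| <= C1) /\
    (forall ij : 'I_n * 'I_n, `|'D_(unitv R ij.2) (w ij.1) y| <= C2).
  by apply: filterS2 w_le Dw_le.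
move=> /nbhs_ballP[e /= e0 eB].
have sr x : ball a (Num.min e r) x -> ball a r x.
  by apply: le_ball; rewrite ge_min lexx orbT.
have se x : ball a (Num.min e r) x -> ball a e x.
  by apply: le_ball; rewrite ge_min lexx.
exists (Num.min e r); first by rewrite lt_min e0 r0 ge_min lexx orbT.
exists (segment_primitive w a) => x; apply: (@segment_primitiveP w a _ (Num.max C1 C2)).
- by rewrite lt_min e0 r0.
- by move=> i y /sr; exact: dw.
- by move=> i j y /sr; exact: cw.
- by move=> i j y /sr; exact: w_closed.
- by move=> i y /se /eB[+ _] => /(_ i) h; rewrite le_max h.
- by move=> i j y /se /eB[_ /(_ (i,j)) /= h]; rewrite le_max h orbT.
Qed.

End poincare.

(** * Local solutions of dh - h th = w *)

Section solutions.
Context (R : realType) (n : nat).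
Notation E := 'rV[R]_n.
Implicit Types (x y a v : E).

Lemma near_eq_differentiable (f g : E -> R^o) x :
  (\forall y \near x, f y = g y) -> differentiable f x -> differentiable g x.
Proof.
move=> fg df; have fgx : f x = g x := nbhs_singleton fg.
have cdf := diff_continuous df.
have go : forall e : R, 0 < e ->
    \forall h \near (0 : E), `|(g \o shift x - (cst (g x) + 'd f x)) h| <= e * `|h|.
  move=> e e0; have /eqaddoP/(_ e e0) fo := diff_locally df.
  have c : (h + x) @[h --> (0 : E)] --> x.
    rewrite -[X in _ --> X]add0r.
    by apply: (@cvgD _ E _ (nbhs (0 : E)) _ id (cst x)); [exact: cvg_id|exact: cvg_cst].
  have fgn : \forall h \near (0 : E), f (h + x) = g (h + x) by exact: (c _ fg).
  near=> h; have /= fgh : f (h + x) = g (h + x) by near: h.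
  by rewrite !fctE /= -fgh -fgx; near: h.
have dg : 'd g x = 'd f x :> (E -> R^o).
  apply: diff_unique => //; exact/eqaddoP.
apply/diff_locallyP; rewrite dg; split => //; exact/eqaddoP.
Unshelve. all: by end_near. Qed.

Lemma is_derive_curve (h : E -> R^o) (c : R -> E) (s : R) v :
  is_derive s 1 c v -> differentiable h (c s) -> is_derive s 1 (h \o c) ('d h (c s) v).
Proof.
move=> [c1 <-] dh; have dc : differentiable c s by exact/derivable1_diffP.
have dhc := @differentiable_comp R R E R^o c h s dc dh.
apply: DeriveDef; first exact/derivable1_diffP.
rewrite (@deriveE R R R^o (h \o c) s 1 dhc) (@deriveE R R E c s 1 dc).
by rewrite (@diff_comp R R E R^o c h s dc dh).
Qed.

(** Meant for transition maps, whose directional derivatives are at hand; the chain rule is applied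
    to the curve s |-> phi (x + s *: v). *)
Lemma is_derive_comp (h : E -> R^o) (phi : E -> E) x v :
  derivable phi x v -> differentiable h (phi x) ->
  is_derive x v (h \o phi) ('d h (phi x) ('D_v phi x)).
Proof.
move=> dphi dh; have x0 : x + (0 : R) *: v = x by rewrite scale0r addr0.
have dphi0 : derivable phi (x + (0 : R) *: v) v by rewrite x0.
have dh0 : differentiable h (phi (x + (0 : R) *: v)) by rewrite x0.
have [h1 h2] := is_derive_curve (is_derive_line dphi0) dh0.
by rewrite x0 in h2; apply: DeriveDef; [exact: derivable_line|rewrite derive_line].
Qed.

(** The equation dh - h th = w at the single point x. For th = 0 it describes the primitives of w,
    for w = 0 the multiples of e^F with dF = th. *)
Definition solves (th w : 'I_n -> E -> R) (h : E -> R) x : Prop :=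
  differentiable (h : E -> R^o) x /\
  forall i, 'D_(unitv R i) (h : E -> R^o) x = th i x * h x + w i x.

Lemma solvesB th w w' h h' x : solves th w h x -> solves th w' h' x ->
  solves th (fun i y => w i y - w' i y) (fun y => h y - h' y) x.
Proof.
move=> [dh Dh] [dh' Dh']; split; first exact: (differentiableB dh dh').
move=> i; rewrite (deriveB (diff_derivable dh) (diff_derivable dh')) Dh Dh'.
by ring.
Qed.

Lemma solvesZ th w h x (k : R) : solves th w h x ->
  solves th (fun i y => k * w i y) (fun y => k * h y) x.
Proof.
move=> [dh Dh]; split; first exact: (differentiableZ k dh).
move=> i; rewrite (deriveZ k (diff_derivable dh)) Dh.
by rewrite /GRing.scale /=; ring.
Qed.

(** Twists add under products. With h = e^F or h = e^(-F) from [solves_exp], this introduces or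
    removes the twist. *)
Lemma solvesM th th' w h h' x : solves th (fun _ => cst 0) h x -> solves th' w h' x ->
  solves (fun i y => th i y + th' i y) (fun i y => h y * w i y) (fun y => h y * h' y) x.
Proof.
move=> [dh Dh] [dh' Dh']; split; first exact: (differentiableM dh dh').
move=> i; rewrite (deriveM (diff_derivable dh) (diff_derivable dh')) Dh Dh'.
by rewrite /GRing.scale /=; ring.
Qed.

Lemma solves_exp th F x : solves (fun _ => cst 0) th F x ->
  solves th (fun _ => cst 0) (expR \o F) x.
Proof.
move=> [dF DF]; have de : differentiable (expR : R -> R^o) (F x).
  exact/derivable1_diffP/derivable_expR.
split; first exact: (@differentiable_comp R E R^o R^o F expR x dF de).
move=> i; rewrite deriveE; last exact: (@differentiable_comp R E R^o R^o F expR x dF de).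
rewrite (@diff_comp R E R^o R^o F expR x dF de) /=.
rewrite -[X in 'd _ _ X]deriveE // DF /= mul0r add0r addr0.
rewrite (_ : th i x = th i x *: (1 : R^o)); last by rewrite [RHS]mulr1.
rewrite linearZ /= -deriveE //; have [_ De] := is_derive_expR (F x).
by rewrite [_ *: (1 : R^o)]mulr1; congr (_ * _); exact: De.
Qed.

Lemma near_eq_solves th w h h' x : (\forall y \near x, h y = h' y) ->
  solves th w h x -> solves th w h' x.
Proof.
move=> hh' [dh Dh]; split; first exact: near_eq_differentiable dh.
by move=> i; rewrite -(nbhs_singleton hh') -Dh; apply/esym/near_eq_derive.
Qed.

Lemma eq_solves th th' w w' h x : (forall i, th i x = th' i x) ->
  (forall i, w i x = w' i x) -> solves th w h x -> solves th' w' h x.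
Proof. by move=> ththE wwE [dh Dh]; split=> // i; rewrite Dh ththE wwE. Qed.

Lemma solves0_cst (h : E -> R) a (r : R) :
  (forall x, ball a r x -> solves (fun _ => cst 0) (fun _ => cst 0) h x) ->
  forall x y, ball a r x -> ball a r y -> h x = h y.
Proof.
move=> hs; apply: (@zero_partials_cst R n h a r).
- by move=> y /hs[].
- by move=> y i /hs[_ ->]; rewrite /= mul0r addr0.
Qed.

(* e^(-F) times the difference of two solutions is locally constant. *)
Lemma solves_eq th w F h h' a (r : R) :
  (forall x, ball a r x -> solves (fun _ => cst 0) th F x) ->
  (forall x, ball a r x -> solves th w h x) ->
  (forall x, ball a r x -> solves th w h' x) ->
  forall x y, ball a r x -> ball a r y -> h x = h' x -> h y = h' y.
Proof.
move=> Fs hs hs' x y xr yr hx.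
pose g z := expR (0 - F z) * (h z - h' z).
have gs z : ball a r z -> solves (fun _ => cst 0) (fun _ => cst 0) g z.
  move=> zr.
  have s0 : solves (fun _ : 'I_n => cst 0) (fun _ : 'I_n => cst 0) (cst 0 : E -> R) z.
    by split; [exact: differentiable_cst|move=> i; rewrite derive_cst /= mul0r addr0].
  have := solvesM (solves_exp (solvesB s0 (Fs z zr))) (solvesB (hs z zr) (hs' z zr)).
  by apply: eq_solves => i /=; ring.
have gxy : g x = g y by exact: (solves0_cst gs).
apply/eqP; rewrite -subr_eq0; have /eqP : g y = 0 by rewrite -gxy /g hx subrr mulr0.
by rewrite /g mulf_eq0 expR_eq0.
Qed.

(* w = dh - h th amounts to e^(-F) w = d(e^(-F) h), and e^(-F) w is closed. *)
Lemma twisted_poincare (th w : 'I_n -> E -> R) a (r : R) : 0 < r ->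
  (forall i x, ball a r x -> differentiable (th i : E -> R^o) x) ->
  (forall i x, ball a r x -> differentiable (w i : E -> R^o) x) ->
  (forall i j x, ball a r x -> {for x, continuous ('D_(unitv R j) (th i : E -> R^o))}) ->
  (forall i j x, ball a r x -> {for x, continuous ('D_(unitv R j) (w i : E -> R^o))}) ->
  (forall i j x, ball a r x ->
    'D_(unitv R i) (th j : E -> R^o) x = 'D_(unitv R j) (th i : E -> R^o) x) ->
  (forall i j x, ball a r x ->
    'D_(unitv R i) (w j : E -> R^o) x - 'D_(unitv R j) (w i : E -> R^o) x =
    th i x * w j x - th j x * w i x) ->
  exists2 s : R, 0 < s <= r &
    (exists F, forall x, ball a s x -> solves (fun _ => cst 0) th F x) /\
    forall y (v : R), ball a s y ->
      exists2 h, h y = v & forall x, ball a s x -> solves th w h x.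
Proof.
move=> r0 dth dw cth cw th_closed w_closed.
have [s /andP[s0 sr] [F FP]] := poincare r0 dth cth (fun i j x xr => th_closed j i x xr).
have sB x : ball a s x -> ball a r x by exact: le_ball.
have Fs x : ball a s x -> solves (fun _ => cst 0) th F x.
  by move=> /FP[dF DF]; split => // i; rewrite DF /= mul0r add0r.
have Ns x : ball a s x -> solves (fun i y => 0 - th i y) (fun _ => cst 0) (fun y => expR (0 - F y)) x.
  move=> xs; apply: (@solves_exp _ (fun y => 0 - F y)).
  apply: solvesB (Fs x xs).
  by split; [exact: differentiable_cst|move=> i; rewrite derive_cst /= mul0r addr0].
pose u i y : R^o := expR (0 - F y) * w i y.
have du i x : ball a s x -> differentiable (u i) x.
  move=> xs; have [dN _] := Ns x xs; apply: differentiableM => //; exact/dw/sB.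
have Du i j x : ball a s x -> 'D_(unitv R j) (u i) x =
    expR (0 - F x) * ('D_(unitv R j) (w i : E -> R^o) x - th j x * w i x).
  move=> xs; have [dN DN] := Ns x xs.
  rewrite (deriveM (diff_derivable dN) (diff_derivable (dw i x (sB x xs)))) DN.
  by rewrite /GRing.scale /=; ring.
have cu i j x : ball a s x -> {for x, continuous ('D_(unitv R j) (u i))}.
  move=> xs; have xr := sB x xs.
  suff : 'D_(unitv R j) (u i) y @[y --> x] -->
      expR (0 - F x) * ('D_(unitv R j) (w i : E -> R^o) x - th j x * w i x).
    by rewrite -Du.
  have : expR (0 - F y) * ('D_(unitv R j) (w i : E -> R^o) y - th j y * w i y) @[y --> x] -->
      expR (0 - F x) * ('D_(unitv R j) (w i : E -> R^o) x - th j x * w i x).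
    have [dN _] := Ns x xs.
    exact: (cvgM (differentiable_continuous dN) (cvgB (cw i j x xr)
      (cvgM (differentiable_continuous (dth j x xr)) (differentiable_continuous (dw i x xr))))).
  apply: cvg_trans; apply: (@near_eq_cvg _ _ (nbhs x)); near=> y; rewrite Du //.
  by near: y; apply: open_nbhs_nbhs; split => //; exact: ball_open.
have u_closed i j x : ball a s x -> 'D_(unitv R j) (u i) x = 'D_(unitv R i) (u j) x.
  move=> xs; rewrite !Du //; congr (_ * _); have := w_closed i j x (sB x xs); lra.
have [t /andP[t0 ts] [U UP]] := poincare s0 du cu u_closed.
have tB x : ball a t x -> ball a s x by exact: le_ball.
exists t; first by rewrite t0 (le_trans ts).
split; first by exists F => x /tB; exact: Fs.
(* The integration constant k makes e^F (U + k) take the value v at y. *)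
move=> y v yt; pose k : R := expR (0 - F y) * v - U y.
exists (fun x => expR (F x) * (U x + k)).
  by rewrite /k subrKC mulrA -expRD sub0r subrr expR0 mul1r.
move=> x xt; have xs := tB x xt.
have Us : solves (fun _ => cst 0) (fun i y => u i y) (fun z => U z + k) x.
  have [dU DU] := UP x xt.
  split; first exact: (differentiableD dU (differentiable_cst (k : R^o) x)).
  move=> i; rewrite (deriveD (diff_derivable dU) (derivable_cst (k : R^o) _ _)).
  by rewrite derive_cst addr0 DU /= mul0r add0r.
have := solvesM (solves_exp (Fs x xs)) Us.
apply: eq_solves => i /=; first by rewrite addr0.
by rewrite /u mulrA -expRD sub0r subrr expR0 mul1r.
Unshelve. all: by end_near. Qed.

End solutions.

(** * Continuation of solutions along paths *)

(** Relative to B, the locus of P is open and closed. The witnesses are interiors of sets containing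
    the complement of B, because P is controlled along B only. *)
Lemma connected_locally_constant (Z : topologicalType) (B P : set Z) :
  connected B -> (forall z, B z -> \forall y \near z, B y -> (P y <-> P z)) ->
  forall y z, B y -> B z -> P y -> P z.
Proof.
move=> cB locP y z By Bz Py.
suff e : B `&` P = B by have [] : (B `&` P) z by rewrite e.
apply: cB; first by exists y.
- exists (interior (~` B `|` P)); first exact: open_interior.
  apply/seteqP; split => x [Bx Px]; split => //.
    by apply: filterS (locP x Bx) => t tP; have [/tP[_ /(_ Px)]|] := pselect (B t); [right|left].
  by have [|] := interior_subset Px.
- exists (~` interior (~` B `|` ~` P)); first exact/open_closedC/open_interior.
  apply/seteqP; split => x [Bx Px]; split => //.
    by move=> /interior_subset[].
  apply: contrapT => nPx; apply: Px.
  by apply: filterS (locP x Bx) => t tP; have [/tP[+ _]|] := pselect (B t); [right=> /a|left].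
Qed.

Section cousin.
Context (R : realType).

(** A small interval around the supremum m of the t with [P a t] reaches m, and passes beyond it if
    m < b, which is absurd. Compactness of the segment is used in this form. *)
Lemma cousin (P : R -> R -> Prop) (a b : R) : a <= b ->
  (forall t, a <= t <= b -> exists2 e, 0 < e & forall u v, a <= u -> v <= b ->
     u <= t <= v -> t - e < u -> v < t + e -> P u v) ->
  (forall u v w, a <= u -> u <= v -> v <= w -> w <= b -> P u v -> P v w -> P u w) ->
  P a b.
Proof.
move=> ab Ploc Padd.
pose S := [set t | a <= t <= b /\ P a t].
have aab : a <= a <= b by rewrite lexx.
have Sa : S a.
  split => //; have [e e0 h] := Ploc a aab.
  by apply: h; rewrite ?lexx ?ab // ?ltrDl ?ltrBlDr ?ltrDl.
have hS : has_sup S by split; [exists a|exists b => t [/andP[]]].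
pose m := sup S.
have am : a <= m by exact: ub_le_sup hS.2 _ Sa.
have mb : m <= b by apply: ge_sup; [exists a|move=> t [/andP[]]].
have mab : a <= m <= b by rewrite am.
have [e e0 Pm] := Ploc m mab.
have [t [/andP[at_ tb] Pat] mt] := sup_adherent e0 hS.
have tm : t <= m by apply: ub_le_sup => //; [exact: hS.2|split => //; rewrite at_].
have [mb'|bm] := ltP m b; last first.
  have -> : b = m by apply/le_anti; rewrite mb bm.
  apply: (Padd a t m) => //; apply: Pm => //; [by rewrite tm lexx|by rewrite ltrDl].
exfalso; pose s := Num.min b (m + e / 2).
have ms : m < s by rewrite lt_min mb' ltrDl divr_gt0.
have sb : s <= b by rewrite ge_min lexx.
have : S s.
  split; first by rewrite sb andbT (le_trans am (ltW ms)).
  apply: (Padd a t s) => //; first exact: le_trans tm (ltW ms).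
  apply: Pm => //; first by rewrite tm ltW.
  by rewrite gt_min ltrD2l ltr_pdivrMr // mulr_natr mulr2n ltrDl e0 orbT.
move=> /(ub_le_sup hS.2); rewrite leNgt => /negP; apply; exact: ms.
Qed.

End cousin.

(** * Local systems and lifts of maps to them *)

Section local_system.
Context (R : realType) (T : topologicalType) (L : (T -> R) -> T -> Prop).

(** [L h p] reads: h is a solution at p. The paths inside U make all points of U accessible to
    transport. By [separation], both agreement and disagreement of two solutions at p spread to a
    neighbourhood. *)
Record local_system : Prop := {
  local_solutions : forall p, exists U : set T, [/\ open U, U p,
    (forall q q', U q -> U q' -> exists g : R -> T, [/\ {within `[0%R, 1%R], continuous g},
       g 0 = q, g 1 = q' & forall t, 0 <= t <= 1 -> U (g t)]) &
    (forall q v, U q -> exists2 h, h q = v & forall p', U p' -> L h p')];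
  separation : forall p h h', (\forall q \near p, L h q) -> (\forall q \near p, L h' q) ->
    \forall q \near p, (h q = h' q <-> h p = h' p) }.

Hypothesis sL : local_system.

(** A lift records only the values of the continued solution, since by [separation] a value
    determines the germ. K is unconstrained outside B, which allows gluing over closed sets. *)
Definition is_lift (Z : topologicalType) (B : set Z) (H : Z -> T) (K : Z -> R) : Prop :=
  forall z, B z -> exists2 h, (\forall p \near H z, L h p) &
    \forall y \near z, B y -> K y = h (H y).

Section lifts.
Context {Z : topologicalType}.
Implicit Types (B : set Z) (H : Z -> T) (K : Z -> R).

Lemma lift_eq B H H' K K' : (forall z, B z -> H z = H' z) -> (forall z, B z -> K z = K' z) ->
  is_lift B H K -> is_lift B H' K'.
Proof.
move=> HH' KK' lK z Bz; have [h Lh Kh] := lK z Bz.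
exists h; first by rewrite -HH'.
by apply: filterS Kh => y Kh By; rewrite -KK' // -HH' // Kh.
Qed.

Lemma lift_comp (Z' : topologicalType) (B' : set Z') B H K (phi : Z' -> Z) :
  {within B', continuous phi} -> (forall z, B' z -> B (phi z)) ->
  is_lift B H K -> is_lift B' (H \o phi) (K \o phi).
Proof.
move=> /subspace_continuousP cphi phiB lK z Bz; have [h Lh Kh] := lK (phi z) (phiB z Bz).
exists h => //; have := cphi z Bz _ Kh; rewrite /= /within /= /nbhs /=.
by apply: filterS => y /= h1 By; apply: h1 => //; exact: phiB.
Qed.

Lemma lift_section B H (U : set T) h : open U -> (forall p, U p -> L h p) ->
  (forall z, B z -> U (H z)) -> is_lift B H (h \o H).
Proof.
move=> oU Lh BU z Bz; exists h; last exact: nearW.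
by apply: filterS Lh _; apply: open_nbhs_nbhs; split => //; exact: BU.
Qed.

(** Pulled back along H, [separation] makes the agreement of K and K' locally constant on B. *)
Lemma lift_unique B H K K' : connected B -> {within B, continuous H} ->
  is_lift B H K -> is_lift B H K' ->
  forall y z, B y -> B z -> K y = K' y -> K z = K' z.
Proof.
move=> cB /subspace_continuousP cH lK lK'.
apply: (@connected_locally_constant _ B [set z | K z = K' z]) => // z Bz.
have [h Lh Kh] := lK z Bz; have [h' Lh' Kh'] := lK' z Bz.
have := cH z Bz _ (separation sL Lh Lh'); rewrite /within /nbhs /= => sep.
have Kz := nbhs_singleton Kh Bz; have K'z := nbhs_singleton Kh' Bz.
near=> y => By; rewrite /= Kz K'z.
have -> : K y = h (H y) by apply: (near Kh y) => //; near: y.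
have -> : K' y = h' (H y) by apply: (near Kh' y) => //; near: y.
by move: By; near: y.
Unshelve. all: by end_near. Qed.

(** On the connected overlap the two lifts agree by uniqueness, starting from z0. At a point of the
    overlap the two local solutions then agree, hence also nearby by [separation]; at any other
    point closedness keeps the other set away. *)
Lemma liftU B B' H K K' z0 : closed B -> closed B' -> connected (B `&` B') ->
  {within B `|` B', continuous H} -> is_lift B H K -> is_lift B' H K' ->
  B z0 -> B' z0 -> K z0 = K' z0 ->
  is_lift (B `|` B') H (fun z => if `[< B z >] then K z else K' z).
Proof.
move=> clB clB' cBB' cH lK lK' Bz0 B'z0 K0.
have cBB'H : {within B `&` B', continuous H}.
  by apply: continuous_subspaceW cH => z [Bz _]; left.
have KK' z : B z -> B' z -> K z = K' z.
  move=> Bz B'z; apply: (@lift_unique (B `&` B') H K K' _ _ _ _ z0) => //.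
  - by apply: (@lift_comp _ _ B H K id) => //; [apply: continuous_subspaceT => ?; exact: cvg_id|move=> ? []].
  - by apply: (@lift_comp _ _ B' H K' id) => //; [apply: continuous_subspaceT => ?; exact: cvg_id|move=> ? []].
have nC (C : set Z) z : closed C -> ~ C z -> \forall y \near z, ~ C y.
  by move=> clC nCz; apply: open_nbhs_nbhs; split => //; exact: closed_openC.
set K'' := fun z => if `[< B z >] then K z else K' z.
have K''B z : B z -> K'' z = K z by rewrite /K'' => /asboolT ->.
have K''B' z : B' z -> K'' z = K' z.
  by move=> B'z; rewrite /K''; case: asboolP => // Bz; exact: KK'.
move=> z; have [Bz _|nBz [//|B'z]] := pselect (B z); last first.
  have [h Lh Kh] := lK' z B'z; exists h => //.
  apply: filterS2 (nC B z clB nBz) Kh => y nBy Kh [//|B'y].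
  by rewrite K''B' // Kh.
have [h Lh Kh] := lK z Bz; exists h => //.
have [B'z|nB'z] := pselect (B' z); last first.
  by apply: filterS2 (nC B' z clB' nB'z) Kh => y nBy Kh [By|//]; rewrite K''B // Kh.
have [h' Lh' Kh'] := lK' z B'z.
have /subspace_continuousP cH' := cH.
have BB'z : (B `|` B') z by left.
have := cH' z BB'z _ (separation sL Lh Lh'); rewrite /within /nbhs /= => sep.
have hh' : h (H z) = h' (H z).
  by rewrite -(nbhs_singleton Kh Bz) -(nbhs_singleton Kh' B'z) KK'.
near=> y => -[By|B'y]; first by rewrite K''B //; move: By; near: y.
rewrite K''B' // (_ : K' y = h' (H y)); last by move: B'y; near: y.
have : (B `|` B') y -> h (H y) = h' (H y) <-> h (H z) = h' (H z) by near: y.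
by move=> /(_ (or_intror B'y)) [_ ->].
Unshelve. all: by end_near. Qed.

(** The initial value may be prescribed at any point, so that a continuation over a union can begin
    in either piece and enter the other one at a common point. *)
Definition extendable B H := forall z v, B z -> exists2 K, is_lift B H K & K z = v.

Lemma extendableU B B' H z0 : closed B -> closed B' -> connected (B `&` B') ->
  {within B `|` B', continuous H} -> B z0 -> B' z0 ->
  extendable B H -> extendable B' H -> extendable (B `|` B') H.
Proof.
move=> clB clB' cBB' cH Bz0 B'z0 eB eB' z v BB'z.
have [Bz|nBz] := pselect (B z).
  have [K lK Kz] := eB z v Bz; have [K' lK' K'z] := eB' z0 (K z0) B'z0.
  exists (fun z => if `[< B z >] then K z else K' z); first exact: (liftU (z0 := z0)).
  by rewrite asboolT.
have B'z : B' z by case: BB'z.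
have [K' lK' Kz] := eB' z v B'z; have [K lK K'z] := eB z0 (K' z0) Bz0.
exists (fun z => if `[< B z >] then K z else K' z); first exact: (liftU (z0 := z0)).
by rewrite asboolF.
Qed.

End lifts.
End local_system.

(** * Continuation over the unit square *)

Section square.
Context (R : realType) (T : topologicalType) (L : (T -> R) -> T -> Prop).
Hypothesis sL : local_system L.

Lemma continuous_pair_fun (X : topologicalType) (f g : X -> R) : continuous f ->
  continuous g -> continuous (fun x => (f x, g x)).
Proof. by move=> cf cg x; exact: (cvg_pair (cf x) (cg x)). Qed.

Lemma continuous_pairl (v : R) : continuous (fun x : R => (v, x)).
Proof.
by apply: (@continuous_pair_fun R (cst v) id); [exact: cst_continuous|move=> x; exact: cvg_id].
Qed.

Lemma continuous_pairr (v : R) : continuous (fun x : R => (x, v)).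
Proof.
by apply: (@continuous_pair_fun R id (cst v)); [move=> x; exact: cvg_id|exact: cst_continuous].
Qed.

Definition rect (u v s t : R) : set (R * R) := `[u, v] `*` `[s, t].

Lemma rectP u v s t p : rect u v s t p <-> u <= p.1 <= v /\ s <= p.2 <= t.
Proof. by rewrite /rect /= !in_itv. Qed.

Lemma closed_rect u v s t : closed (rect u v s t).
Proof.
rewrite (_ : rect u v s t = fst @^-1` `[u, v] `&` snd @^-1` `[s, t]) //.
apply: closedI; apply: closed_comp; try exact: interval_closed.
  by move=> p _; exact: cvg_fst.
by move=> p _; exact: cvg_snd.
Qed.

(** A small rectangle is mapped into the domain U of local solutions, where a lift is a solution
    composed with H. [cousin] is used twice: small rectangles are stacked in the second coordinate
    to a strip of full height, and strips are joined in the first. *)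
Lemma extendable_square (H : R * R -> T) :
  {within rect 0 1 0 1, continuous H} ->
  extendable L (rect 0 1 0 1) H.
Proof.
move=> cH; have cH' u v s t : 0 <= u -> v <= 1 -> 0 <= s -> t <= 1 ->
    {within rect u v s t, continuous H}.
  move=> u0 v1 s0 t1; apply: continuous_subspaceW cH => p /rectP[/andP[? ?] /andP[? ?]].
  by apply/rectP; split; apply/andP; split; lra.
have gluex u v w : 0 <= u -> u <= v -> v <= w -> w <= 1 ->
    extendable L (rect u v 0 1) H -> extendable L (rect v w 0 1) H ->
    extendable L (rect u w 0 1) H.
  move=> u0 uv vw w1 e1 e2.
  have U : rect u w 0 1 = rect u v 0 1 `|` rect v w 0 1.
    apply/seteqP; split => [p /rectP[/andP[pu pw] p2]|p [] /rectP[/andP[pu pv] p2]].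
    - have [pv|/ltW pv] := leP p.1 v; [left|right]; apply/rectP; split=> //; exact/andP.
    - by apply/rectP; split => //; apply/andP; lra.
    - by apply/rectP; split => //; apply/andP; lra.
  rewrite U; apply: (extendableU sL (z0 := (v, 0))) e1 e2; rewrite -?U.
  - exact: closed_rect.
  - exact: closed_rect.
  - rewrite (_ : _ `&` _ = (fun x => (v, x)) @` `[0%R, 1%R]).
      apply: connected_continuous_connected; first exact: segment_connected.
      apply: continuous_subspaceT; exact: continuous_pairl.
    apply/seteqP; split => [[p1 p2] [] /rectP /= [/andP[? ?] p201] /rectP /= [/andP[? ?] _]|_ [x x01 <-]].
      by exists p2; [rewrite /= in_itv|congr pair; apply/le_anti/andP].
    by move: x01; rewrite /= in_itv /= => ?; split; apply/rectP; rewrite /= lexx ?uv ?vw.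
  - exact: cH'.
  - by apply/rectP; rewrite /= !lexx uv ler01.
  - by apply/rectP; rewrite /= !lexx vw ler01.
have gluey u v r s t : 0 <= u -> u <= v -> v <= 1 -> 0 <= r -> r <= s -> s <= t -> t <= 1 ->
    extendable L (rect u v r s) H -> extendable L (rect u v s t) H ->
    extendable L (rect u v r t) H.
  move=> u0 uv v1 r0 rs st t1 e1 e2.
  have U : rect u v r t = rect u v r s `|` rect u v s t.
    apply/seteqP; split => [p /rectP[p1 /andP[pr pt]]|p [] /rectP[p1 /andP[pr ps]]].
    - have [ps|/ltW ps] := leP p.2 s; [left|right]; apply/rectP; split=> //; exact/andP.
    - by apply/rectP; split => //; apply/andP; lra.
    - by apply/rectP; split => //; apply/andP; lra.
  rewrite U; apply: (extendableU sL (z0 := (u, s))) e1 e2; rewrite -?U.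
  - exact: closed_rect.
  - exact: closed_rect.
  - rewrite (_ : _ `&` _ = (fun x => (x, s)) @` `[u, v]).
      apply: connected_continuous_connected; first exact: segment_connected.
      apply: continuous_subspaceT; exact: continuous_pairr.
    apply/seteqP; split => [[p1 p2] [] /rectP /= [p1uv /andP[? ?]] /rectP /= [_ /andP[? ?]]|_ [x x01 <-]].
      by exists p1; [rewrite /= in_itv|congr pair; apply/le_anti/andP].
    by move: x01; rewrite /= in_itv /= => ?; split; apply/rectP; rewrite /= lexx ?rs ?st.
  - exact: cH'.
  - by apply/rectP; rewrite /= !lexx uv rs.
  - by apply/rectP; rewrite /= !lexx uv st.
apply: (@cousin R (fun u v => extendable L (rect u v 0 1) H) 0 1 ler01) => // s s01.
(* The width e of the strip belongs to Q, so that stacking two rectangles may pass to the smaller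
   width. *)
pose Q t t' := exists2 e : R, 0 < e & forall u v, 0 <= u -> v <= 1 -> u <= s <= v ->
  s - e < u -> v < s + e -> extendable L (rect u v t t') H.
apply: (@cousin R Q 0 1 ler01) => [t t01|t t' t'' t0 tt' t't'' t''1 [e e0 he] [e' e0' he']]; last first.
  exists (Num.min e e'); first by rewrite lt_min e0.
  move=> u v u0 v1 /andP[us sv] su vs; apply: (gluey _ _ _ t') => //; first exact: le_trans sv.
  - apply: he; rewrite ?us //.
      by apply: le_lt_trans su; rewrite lerD2l lerN2 ge_min lexx.
    by apply: lt_le_trans vs _; rewrite lerD2l ge_min lexx.
  - apply: he'; rewrite ?us //.
      by apply: le_lt_trans su; rewrite lerD2l lerN2 ge_min lexx orbT.
    by apply: lt_le_trans vs _; rewrite lerD2l ge_min lexx orbT.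
have [U [oU Ust _ LU]] := local_solutions sL (H (s, t)).
have st01 : rect 0 1 0 1 (s, t) by exact/rectP.
have nU : nbhs (H (s, t)) U by exact: open_nbhs_nbhs.
have /subspace_continuousP/(_ _ st01 _ nU) := cH.
rewrite /within /= => /nbhs_ballP[e /= e0 eB].
have eU u v t1 t2 : 0 <= u -> v <= 1 -> 0 <= t1 -> t2 <= 1 ->
    s - e < u -> v < s + e -> t - e < t1 -> t2 < t + e ->
    forall p, rect u v t1 t2 p -> U (H p).
  move=> u0 v1 t10 t21 su vs tt1 t2t [x y] /rectP /= [/andP[ux xv] /andP[ty yt]].
  apply: eB; last by apply/rectP => /=; split; apply/andP; lra.
  by split => /=; rewrite -ball_normE /= ltr_distl; apply/andP; lra.
exists e => // t1 t2 t10 t21 /andP[t1t tt2] tt1 t2t; exists e => // u v u0 v1 _ su vs z w zB.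
have [h hz Lh] := LU (H z) w (eU u v t1 t2 u0 v1 t10 t21 su vs tt1 t2t z zB).
exists (h \o H) => //; apply: lift_section oU Lh _; exact: eU.
Qed.

End square.

(** * Transport along paths, homotopy invariance and global solutions *)

Section transport.
Context (R : realType) (T : topologicalType).
Implicit Types (L : (T -> R) -> T -> Prop).
Local Notation I01 := (`[0%R, 1%R]%classic : set R).

Definition transport L (g : R -> T) (v : R) : R :=
  xget 0 [set v' | exists K, [/\ is_lift L I01 g K, K 0 = v & K 1 = v']].

Definition is_path (g : R -> T) : Prop := {within `[0%R, 1%R], continuous g}.

(** The formula of [concat_fun] for paths with arbitrary ends, so that results on it apply to
    [concat_loop] by conversion. *)
Definition path_cat (f g : R -> T) (t : R) : T :=
  if t <= 2^-1 then f (2 * t) else g (2 * t - 1).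

Lemma in01 (t : R) : (`[0%R, 1%R]%classic : set R) t <-> 0 <= t <= 1.
Proof. by rewrite /= in_itv. Qed.

Lemma continuous_affine (a b : R) : continuous (fun t : R => a * t + b).
Proof.
move=> t; apply: cvgD; last exact: cvg_cst.
by apply: cvgM; [exact: cvg_cst|exact: cvg_id].
Qed.

Lemma path_affine (g : R -> T) (a b : R) (A : set R) :
  (forall t, A t -> 0 <= a * t + b <= 1) -> is_path g ->
  {within A, continuous (fun t => g (a * t + b))}.
Proof.
move=> h pg; apply: (@within_comp R R T A `[0%R, 1%R] (fun t => a * t + b) g) => //.
  by apply: continuous_subspaceT; exact: continuous_affine.
by move=> _ [t At <-]; apply/in01/h.
Qed.

Lemma path_cat_path (f g : R -> T) : is_path f -> is_path g -> f 1 = g 0 -> is_path (path_cat f g).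
Proof.
move=> pf pg fg; rewrite /is_path.
have -> : I01 = `[0%R, 2^-1] `|` `[2^-1, 1%R].
  apply/seteqP; split => t /=; rewrite !in_itv /=.
    by move=> /andP[t0 t1]; have [|/ltW] := leP t 2^-1; [left|right]; apply/andP.
  by move=> [/andP[? ?]|/andP[? ?]]; apply/andP; lra.
apply: (@within_paste R T _ _ (fun t => f (2 * t + 0)) (fun t => g (2 * t + -1))).
- exact: interval_closed.
- exact: interval_closed.
- by apply: path_affine => // t; rewrite /= in_itv /= => /andP[? ?]; apply/andP; lra.
- by apply: path_affine => // t; rewrite /= in_itv /= => /andP[? ?]; apply/andP; lra.
- by move=> t; rewrite /= in_itv /= /path_cat addr0 => /andP[? ->].
- move=> t; rewrite /= in_itv /= /path_cat => /andP[t2 t1].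
  have [t2'|//] := leP t 2^-1.
  have -> : t = 2^-1 by apply/le_anti; rewrite t2 t2'.
  by rewrite mulfV // subrr -fg.
Qed.

Lemma path_rev (g : R -> T) : is_path g -> is_path (fun t => g (1 - t)).
Proof.
move=> pg; rewrite (_ : (fun t => g (1 - t)) = (fun t => g (-1 * t + 1))).
  by apply: path_affine => // t /in01 /andP[? ?]; apply/andP; lra.
by apply/funext => t; congr g; lra.
Qed.

Section monodromy.
Variable L : (T -> R) -> T -> Prop.
Hypothesis sL : local_system L.

(** A path is a map on the square that ignores the first coordinate; a lift over the square is
    restricted to a side. *)
Lemma path_lift (g : R -> T) (v : R) : is_path g ->
  exists2 K, is_lift L I01 g K & K 0 = v.
Proof.
move=> pg; have [] := @extendable_square R T L sL (g \o snd) _ (0, 0) v.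
- apply: (@within_comp (R * R)%type R T (rect 0 1 0 1) I01 snd g) => //.
    by apply: continuous_subspaceT => p; exact: cvg_snd.
  by move=> _ [p /rectP[_ p2] <-]; apply/in01.
- by apply/rectP; rewrite /= lexx ler01.
move=> K lK K0; exists (K \o pair 0) => //.
apply: (@lift_comp _ _ L (R * R)%type R I01 _ _ _ (pair 0)) lK.
  by apply: continuous_subspaceT; exact: continuous_pairl.
by move=> t /in01 t01; apply/rectP; rewrite /= lexx ler01.
Qed.

Lemma lift_eq01 (g : R -> T) K K' : is_path g -> is_lift L I01 g K ->
  is_lift L I01 g K' -> K 0 = K' 0 -> K 1 = K' 1.
Proof.
move=> pg lK lK'; apply: (lift_unique sL _ pg lK lK').
- exact: segment_connected.
- by apply/in01; rewrite lexx ler01.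
- by apply/in01; rewrite lexx ler01.
Qed.

Lemma transport_lift (g : R -> T) K v : is_path g -> is_lift L I01 g K -> K 0 = v ->
  transport L g v = K 1.
Proof.
move=> pg lK Kv; rewrite /transport; case: xgetP => [v' _ /= [K' [lK' K'v <-]]|].
  by apply: (lift_eq01 pg) => //; rewrite K'v.
by move=> /(_ (K 1)) []; exists K.
Qed.

(** A lift of c restricts to lifts of f and of g on the two halves of the segment, and uniqueness
    identifies their end values. *)
Lemma transport_halves (f g c : R -> T) v : is_path c -> is_path f -> is_path g ->
  (forall t, 0 <= t <= 1 -> c (2^-1 * t) = f t) ->
  (forall t, 0 <= t <= 1 -> c (2^-1 * t + 2^-1) = g t) ->
  transport L c v = transport L g (transport L f v).
Proof.
move=> pc pf pg cf cg; have [K lK K0] := path_lift v pc.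
have lf : is_lift L I01 f (fun t => K (2^-1 * t + 0)).
  apply: (@lift_eq _ _ L R I01 (fun t => c (2^-1 * t + 0)) _ (fun t => K (2^-1 * t + 0))) => //.
    by move=> t /in01 t01; rewrite addr0; exact: cf.
  apply: (@lift_comp _ _ L R R I01 _ _ _ (fun t => 2^-1 * t + 0)) lK.
    by apply: continuous_subspaceT; exact: continuous_affine.
  by move=> t /in01 /andP[? ?]; apply/in01/andP; lra.
have lg : is_lift L I01 g (fun t => K (2^-1 * t + 2^-1)).
  apply: (@lift_eq _ _ L R I01 (fun t => c (2^-1 * t + 2^-1)) _ (fun t => K (2^-1 * t + 2^-1))) => //.
  apply: (@lift_comp _ _ L R R I01 _ _ _ (fun t => 2^-1 * t + 2^-1)) lK.
    by apply: continuous_subspaceT; exact: continuous_affine.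
  by move=> t /in01 /andP[? ?]; apply/in01/andP; lra.
rewrite (transport_lift pf lf); last by rewrite mulr0 addr0.
rewrite (transport_lift pg lg); last by congr K; lra.
by rewrite (transport_lift pc lK K0); congr K; lra.
Qed.

Lemma transport_cat (f g : R -> T) v : is_path f -> is_path g -> f 1 = g 0 ->
  transport L (path_cat f g) v = transport L g (transport L f v).
Proof.
move=> pf pg fg; apply: transport_halves => //; first exact: path_cat_path.
- move=> t /andP[t0 t1]; rewrite /path_cat ifT; last lra.
  by congr f; lra.
- move=> t /andP[t0 t1]; rewrite /path_cat; case: ifPn => [t2|_].
    have -> : t = 0 by lra.
    by rewrite -fg; congr f; lra.
  by congr g; lra.
Qed.

Lemma transport_rev (g : R -> T) v : is_path g ->
  transport L (fun t => g (1 - t)) (transport L g v) = v.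
Proof.
move=> pg; have [K lK K0] := path_lift v pg.
have lr : is_lift L I01 (fun t => g (1 - t)) (fun t => K (1 - t)).
  apply: (@lift_comp _ _ L R R I01 _ _ _ (fun t => 1 - t)) lK.
    apply: continuous_subspaceT => t; apply: cvgB; [exact: cvg_cst|exact: cvg_id].
  by move=> t /in01 /andP[? ?]; apply/in01/andP; lra.
rewrite (transport_lift pg lK K0) (transport_lift (path_rev pg) lr); last by rewrite subr0.
by rewrite subrr.
Qed.

Lemma transport_section (g : R -> T) (U : set T) h : is_path g -> open U ->
  (forall p, U p -> L h p) -> (forall t, 0 <= t <= 1 -> U (g t)) ->
  transport L g (h (g 0)) = h (g 1).
Proof.
move=> pg oU Lh gU; rewrite (@transport_lift g (h \o g)) //.
by apply: lift_section oU Lh _ => t /in01; exact: gU.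
Qed.

(** One lift of the homotopy restricts to lifts of f and g on two sides of the square. On the other
    two sides H is constant, and so is the lift, by uniqueness. *)
Lemma transport_homotopic (x0 : T) (f g : loop R x0) v : homotopic f g ->
  transport L f v = transport L g v.
Proof.
move=> [H [cH Hfg Hx]].
have pf : is_path f by exact: loop_continuous.
have pg : is_path g by exact: loop_continuous.
have r00 : rect (0 : R) 1 0 1 (0, 0) by apply/rectP; rewrite /= lexx ler01.
have [K lK K0] := extendable_square sL cH v r00.
have lift_at (phi : R -> R * R) : continuous phi ->
    (forall t, 0 <= t <= 1 -> rect 0 1 0 1 (phi t)) ->
    is_lift L I01 (H \o phi) (K \o phi).
  move=> cphi phiB; apply: (@lift_comp _ _ L (R * R)%type R I01 _ _ _ phi) lK.
    exact: continuous_subspaceT.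
  by move=> t /in01; exact: phiB.
have lf : is_lift L I01 f (fun t => K (0, t)).
  apply: (@lift_eq _ _ L R I01 (H \o pair 0) _ (K \o pair 0)) => //.
    by move=> t t01; have [] := Hfg t t01.
  apply: lift_at; first exact: continuous_pairl.
  by move=> t t01; apply/rectP; rewrite /= lexx ler01.
have lg : is_lift L I01 g (fun t => K (1, t)).
  apply: (@lift_eq _ _ L R I01 (H \o pair 1) _ (K \o pair 1)) => //.
    by move=> t t01; have [] := Hfg t t01.
  apply: lift_at; first exact: continuous_pairl.
  by move=> t t01; apply/rectP; rewrite /= lexx ler01.
have Kcst y : (forall s, 0 <= s <= 1 -> H (s, y) = x0) -> 0 <= y <= 1 ->
    K (0, y) = K (1, y).
  move=> Hy y01.
  have [U [oU Ux _ LU]] := local_solutions sL x0.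
  have [h hx Lh] := LU x0 (K (0, y)) Ux.
  have px : is_path (cst x0) by apply: continuous_subspaceT; exact: cst_continuous.
  have lc : is_lift L I01 (cst x0) (h \o cst x0) by exact: lift_section oU Lh _.
  have lK' : is_lift L I01 (cst x0) (fun s => K (s, y)).
    apply: (@lift_eq _ _ L R I01 (H \o (fun s => (s, y))) _ (K \o (fun s => (s, y)))) => //.
    apply: lift_at; first exact: continuous_pairr.
    by move=> t t01; apply/rectP; rewrite /= y01.
  by rewrite (lift_eq01 px lK' lc) ?hx //= hx.
rewrite (transport_lift pf lf K0) (@transport_lift g (fun t => K (1, t))) //.
  by apply: Kcst; rewrite ?lexx ?ler01 // => s s01; have [] := Hx s s01.
by rewrite -K0; apply/esym/Kcst; rewrite ?lexx ?ler01 // => s s01; have [] := Hx s s01.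
Qed.

(** The value at p is v0 transported along any path from x0 to p: two such paths form a loop, which
    fixes v0. The solution k near p appears because an abstract L need not be stable under replacing
    k by a function that agrees with it near p. *)
Lemma global_solution (x0 : T) (v0 : R) : connected [set: T] ->
  (forall f : loop R x0, transport L f v0 = v0) ->
  exists h : T -> R, forall p : T, exists2 k, (\forall q \near p, L k q) &
    \forall q \near p, h q = k q.
Proof.
move=> cT fixv.
pose reach p v := exists g : R -> T, [/\ is_path g, g 0 = x0, g 1 = p & transport L g v0 = v].
have reach_ext p q v (g : R -> T) : reach p v -> is_path g -> g 0 = p -> g 1 = q ->
    reach q (transport L g v).
  move=> [f [pf f0 f1 <-]] pg g0 g1; exists (path_cat f g); split.
  - by apply: path_cat_path; rewrite // f1.
  - by rewrite /path_cat mulr0 invr_ge0 ler0n.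
  - by rewrite /path_cat ifF; [rewrite -g1; congr g; lra|apply/negbTE; rewrite -ltNge; lra].
  - by rewrite transport_cat // f1.
have reach_unique p v v' : reach p v -> reach p v' -> v = v'.
  move=> [f [pf f0 f1 fv]] [g [pg g0 g1 gv]].
  have pr := path_rev pg; have fr : f 1 = g (1 - 0) by rewrite subr0 f1.
  have c0 : path_cat f (fun t => g (1 - t)) 0 = x0 by rewrite /path_cat mulr0 invr_ge0 ler0n.
  have c1 : path_cat f (fun t => g (1 - t)) 1 = x0.
    by rewrite /path_cat ifF; [rewrite -g0; congr g; lra|apply/negbTE; rewrite -ltNge; lra].
  have /= := fixv (Loop (path_cat_path pf pr fr) c0 c1).
  rewrite transport_cat // fv => h.
  rewrite -gv -[in RHS]h.
  have := transport_rev v pr.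
  rewrite (_ : (fun t => g (1 - (1 - t))) = g) //.
  by apply/funext => t; rewrite subKr.
(* The set of points reached by paths is open and closed, so connectedness suffices. *)
have reach_total p : exists v, reach p v.
  apply: (@connected_locally_constant T setT [set p | exists v, reach p v] _ _ x0) => //.
  - move=> q _; have [U [oU Uq pU _]] := local_solutions sL q.
    have : \forall q' \near q, U q' by exact: open_nbhs_nbhs.
    apply: filterS => q' Uq' _; split => -[v rv].
      have [g [pg g0 g1 _]] := pU q' q Uq' Uq.
      by exists (transport L g v); exact: reach_ext rv pg g0 g1.
    have [g [pg g0 g1 _]] := pU q q' Uq Uq'.
    by exists (transport L g v); exact: reach_ext rv pg g0 g1.
  - exists (transport L (cst x0) v0), (cst x0); split => //.
    by apply: continuous_subspaceT; exact: cst_continuous.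
have [h rh] := choice reach_total.
exists h => p; have [U [oU Up pU LU]] := local_solutions sL p.
have [k kp Lk] := LU p (h p) Up; exists k.
  by apply: filterS Lk _; exact: open_nbhs_nbhs.
have : \forall q \near p, U q by exact: open_nbhs_nbhs.
apply: filterS => q Uq; have [g [pg g0 g1 gU]] := pU p q Up Uq.
apply: reach_unique (rh q) _.
have := reach_ext _ _ _ g (rh p) pg g0 g1.
by rewrite -kp -g0 (transport_section pg oU Lk gU) g1.
Qed.

End monodromy.
End transport.

(** * Differential forms *)

Section smoothness.
Context (R : realType) (n : nat).
Notation E := 'rV[R]_n.
Implicit Types (x y a v : E) (U : set E) (f g : E -> R^o).

Lemma open_near (T : topologicalType) (U : set T) (x : T) : open U -> U x -> \forall y \near x, U y.
Proof. by move=> oU Ux; exact: open_nbhs_nbhs. Qed.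

Lemma Cm_on_continuous (V : normedModType R) m U (f : E -> V) x : Cm_on m U f -> U x -> {for x, continuous f}.
Proof. by case: m => [|m] [cf _]; exact: cf. Qed.

Lemma Cm_on_derivable (V : normedModType R) m U (f : E -> V) x i : Cm_on m.+1 U f -> U x -> derivable f x (unitv R i).
Proof. by move=> [_ /(_ i)[df _]]; exact: df. Qed.

Lemma Cm_onW m U f : Cm_on m.+1 U f -> Cm_on m U f.
Proof.
elim: m f => [|m IH] f [cf Df]; first by split.
by split=> // i; have [df /IH] := Df i.
Qed.

Lemma eq_Cm_on m U f g : open U -> (forall x, U x -> f x = g x) ->
  Cm_on m U f -> Cm_on m U g.
Proof.
move=> oU; elim: m f g => [|m IH] f g fg [cf Df].
  split=> // x Ux; have nU := open_near oU Ux.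
  rewrite /prop_for /continuous_at -fg //; apply: cvg_trans (cf x Ux).
  by apply: (@near_eq_cvg _ _ (nbhs x)); near=> y; apply: fg; near: y.
have fgn x : U x -> \forall y \near x, f y = g y.
  by move=> Ux; apply: filterS (open_near oU Ux) => y; exact: fg.
split=> [x Ux|i].
  rewrite /prop_for /continuous_at -fg //; apply: cvg_trans (cf x Ux).
  by apply: (@near_eq_cvg _ _ (nbhs x)); exact: fgn.
have [df CDf] := Df i; split.
  by move=> x Ux; apply: near_eq_derivable (df x Ux); exact: fgn.
by apply: IH CDf => x Ux; apply: near_eq_derive; exact: fgn.
Unshelve. all: by end_near. Qed.

Lemma Cm_on_cst m U (k : R) : Cm_on m U (cst k : E -> R^o).
Proof.
elim: m k => [|m IH] k; first by split=> [x _|]; [exact: cst_continuous|].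
split=> [x _|i]; first exact: cst_continuous.
split=> [x _|]; first exact: derivable_cst.
rewrite (_ : 'D_(unitv R i) (cst k) = cst 0) //.
by apply/funext => x; rewrite derive_cst.
Qed.

Lemma Cm_onD m U f g : open U -> Cm_on m U f -> Cm_on m U g ->
  Cm_on m U (fun x => f x + g x : R^o).
Proof.
move=> oU; elim: m f g => [|m IH] f g [cf Df] [cg Dg].
  by split=> // x Ux; exact: (cvgD (cf x Ux) (cg x Ux)).
split=> [x Ux|i]; first exact: (cvgD (cf x Ux) (cg x Ux)).
have [df CDf] := Df i; have [dg CDg] := Dg i; split.
  by move=> x Ux; exact: (derivableD (df x Ux) (dg x Ux)).
apply: eq_Cm_on (IH _ _ CDf CDg) => // x Ux.
by rewrite (deriveD (df x Ux) (dg x Ux)).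
Qed.

Lemma Cm_onM m U f g : open U -> Cm_on m U f -> Cm_on m U g ->
  Cm_on m U (fun x => f x * g x : R^o).
Proof.
move=> oU; elim: m f g => [|m IH] f g hf hg.
  by case: hf hg => [cf _] [cg _]; split=> // x Ux; exact: (cvgM (cf x Ux) (cg x Ux)).
have [cf Df] := hf; have [cg Dg] := hg.
split=> [x Ux|i]; first exact: (cvgM (cf x Ux) (cg x Ux)).
have [df CDf] := Df i; have [dg CDg] := Dg i; split.
  by move=> x Ux; exact: (derivableM (df x Ux) (dg x Ux)).
have h := Cm_onD oU (IH _ _ (Cm_onW hf) CDg) (IH _ _ (Cm_onW hg) CDf).
apply: eq_Cm_on h => // x Ux.
by rewrite (deriveM (df x Ux) (dg x Ux)).
Qed.

Lemma smooth_differentiable U f x : open U -> smooth_on U f -> U x -> differentiable f x.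
Proof.
move=> oU sf Ux; apply: differentiable_of_partials => i.
  by apply: filterS (open_near oU Ux) => y Uy; apply: Cm_on_derivable Uy; exact: (sf 1%N).
by have [_ /(_ i)[_ h]] := sf 1%N; exact: (@Cm_on_continuous _ 0 U _ x h Ux).
Qed.

Lemma smooth_derive_continuous U f x i : smooth_on U f -> U x ->
  {for x, continuous ('D_(unitv R i) f)}.
Proof. by move=> sf Ux; have [_ /(_ i)[_ h]] := sf 1%N; exact: (@Cm_on_continuous _ 0 U _ x h Ux). Qed.

(** The equation writes the partial derivatives of g as th g + w, which is of class C^m as soon as g
    is; so g gains one order at each step. *)
Lemma solves_smooth (th w : 'I_n -> E -> R) U g : open U ->
  (forall i, smooth_on U (th i : E -> R^o)) -> (forall i, smooth_on U (w i : E -> R^o)) ->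
  (forall x, U x -> solves th w g x) -> smooth_on U g.
Proof.
move=> oU sth sw sg; elim=> [|m IH].
  by split=> // x /sg[/differentiable_continuous].
split=> [x /sg[/differentiable_continuous]//|i]; split.
  by move=> x /sg[dg _]; exact: diff_derivable.
apply: eq_Cm_on (Cm_onD oU (Cm_onM oU (sth i m) IH) (sw i m)) => // x /sg[_ /(_ i)].
by move=> ->.
Qed.

End smoothness.

Section forms.
Context (R : realType) (n : nat) (M : smoothManifold R n).
Notation E := 'rV[R]_n.
Notation coefs k := (chart M -> {ffun 'I_k -> 'I_n} -> 'rV[R]_n -> R).

Lemma chart_imageP (c : chart M) x : chart_image c x ->
  chart_dom c (param c x) /\ coord c (param c x) = x.
Proof. by move=> [p cp <-]; rewrite coordK. Qed.

Lemma open_chart_image (c : chart M) : open (chart_image c).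
Proof. exact: chart_image_open. Qed.

(** One combinator for sums and differences: [lin (-1) w' w] is w - w'. *)
Definition lin (k : nat) (a : R) (w w' : coefs k) : coefs k :=
  fun c J x => a * w c J x + w' c J x.

Lemma Omega_lin k a (w w' : coefs k) : Omega w -> Omega w' -> Omega (lin a w w').
Proof.
move=> Ow Ow'; split.
- move=> c J m; apply: Cm_onD; first exact: open_chart_image.
    apply: Cm_onM; [exact: open_chart_image|exact: Cm_on_cst|exact: (form_smooth Ow)].
  exact: (form_smooth Ow').
- by move=> c J x nx; rewrite /lin (form_out Ow) // (form_out Ow') // mulr0 addr0.
- move=> c J s x; by rewrite /lin (form_alternating Ow) (form_alternating Ow') mulrDr mulrCA.
- move=> c c' J x cx c'x; rewrite /lin (form_compatible Ow J cx c'x).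
  rewrite (form_compatible Ow' J cx c'x) mulr_sumr -big_split /=.
  by apply: eq_bigr => K _; rewrite mulrDr mulrCA.
Qed.

Lemma Omega0 k : Omega (0 : coefs k).
Proof.
split=> //.
- by move=> c J m; exact: Cm_on_cst.
- by move=> c J s x; rewrite mulr0.
- by move=> c c' J x _ _; rewrite big1 // => K _; rewrite mulr0.
Qed.

Lemma ext_d_lin k a (w w' : coefs k) : Omega w -> Omega w' ->
  ext_d (lin a w w') = lin a (ext_d w) (ext_d w').
Proof.
move=> Ow Ow'; apply/funext => c; apply/funext => J; apply/funext => x.
rewrite /lin /ext_d; case: ifPn => [/set_mem cx|_]; last by rewrite mulr0 addr0.
rewrite mulr_sumr -big_split /=; apply: eq_bigr => j _.
have dv (u : coefs k) : Omega u -> derivable (u c (omit J j) : E -> R^o) x (unitv R (J j)).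
  by move=> Ou; apply: Cm_on_derivable cx; exact: (form_smooth Ou _ _ 1%N).
have h := deriveD (derivableZ (k := a) (dv w Ow)) (dv w' Ow').
rewrite (deriveZ a (dv w Ow)) in h.
have -> : (fun x => a * w c (omit J j) x + w' c (omit J j) x : R^o) =
  (a *: (w c (omit J j) : E -> R^o) + (w' c (omit J j) : E -> R^o)) by [].
by rewrite h /GRing.scale /=; ring.
Qed.

Lemma twisted_d_lin th k a (w w' : coefs k) : Omega w -> Omega w' ->
  twisted_d th (lin a w w') = lin a (twisted_d th w) (twisted_d th w').
Proof.
move=> Ow Ow'; rewrite /twisted_d ext_d_lin //.
apply/funext => c; apply/funext => J; apply/funext => x; rewrite /lin !fctE /wedge1.
rewrite (_ : \sum_(j < k.+1) _ = a * (\sum_(j < k.+1) (-1) ^+ j * th c [ffun=> J j] x *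
    w c (omit J j) x) + \sum_(j < k.+1) (-1) ^+ j * th c [ffun=> J j] x * w' c (omit J j) x).
  by rewrite mulrBr addrACA -opprD.
rewrite mulr_sumr -big_split /=; apply: eq_bigr => j _.
by rewrite mulrDr mulrCA.
Qed.

Lemma twisted_d0 k (w : coefs k) : twisted_d 0 w = ext_d w.
Proof.
apply/funext => c; apply/funext => J; apply/funext => x.
rewrite /twisted_d !fctE /wedge1 big1 ?subr0 // => j _.
by rewrite mulr0 mul0r.
Qed.

End forms.

(** * 1-forms in charts and the change of charts *)

Section one_forms.
Context (R : realType) (n : nat) (M : smoothManifold R n).
Notation E := 'rV[R]_n.
Notation coefs k := (chart M -> {ffun 'I_k -> 'I_n} -> 'rV[R]_n -> R).

Definition form_coef (w : coefs 1) (c : chart M) (i : 'I_n) : E -> R := w c [ffun=> i].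

Definition index2 (i j : 'I_n) : {ffun 'I_2 -> 'I_n} := [ffun k => if k == ord0 then i else j].

Lemma omit_index2_0 i j : omit (index2 i j) ord0 = [ffun=> j].
Proof. by apply/ffunP => k; rewrite !ffunE -val_eqE. Qed.

Lemma omit_index2_1 i j : omit (index2 i j) (lift ord0 ord0) = [ffun=> i].
Proof. by apply/ffunP => k; rewrite !ffunE (ord1 k) -val_eqE. Qed.

Lemma ext_d_index2 (w : coefs 1) c i j x : chart_image c x ->
  ext_d w c (index2 i j) x = 'D_(unitv R i) (form_coef w c j : E -> R^o) x
    - 'D_(unitv R j) (form_coef w c i : E -> R^o) x.
Proof.
move=> cx; rewrite /ext_d mem_set // big_ord_recl big_ord1 omit_index2_0 omit_index2_1.
by rewrite !ffunE /= expr0 mul1r expr1 mulN1r.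
Qed.

Lemma wedge1_index2 (t w : coefs 1) c i j x :
  wedge1 t w c (index2 i j) x =
  form_coef t c i x * form_coef w c j x - form_coef t c j x * form_coef w c i x.
Proof.
rewrite /wedge1 big_ord_recl big_ord1 omit_index2_0 omit_index2_1.
by rewrite !ffunE /= expr0 mul1r expr1 mulN1r mulNr.
Qed.

(** Requiring the equation in all charts around p makes the notion independent of a chart;
    [solves_chart_change] reduces it to the points near p in one chart. *)
Definition msolves (th w : coefs 1) (h : M -> R) (p : M) : Prop :=
  forall c, chart_dom c p -> solves (form_coef th c) (form_coef w c) (h \o param c) (coord c p).

Lemma form_coef_compatible (w : coefs 1) c c' j x : Omega w -> chart_image c x ->
  chart_dom c' (param c x) ->
  form_coef w c j x = \sum_k ('D_(unitv R j) (coord c' \o param c) x) 0 k *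
    form_coef w c' k (coord c' (param c x)).
Proof.
move=> Ow cx c'x; rewrite /form_coef (form_compatible Ow _ cx c'x).
rewrite (reindex_onto (fun k => [ffun=> k] : {ffun 'I_1 -> 'I_n}) (fun K => K ord0)) /=.
  by apply: eq_big => [k|k _]; [rewrite ffunE eqxx|rewrite big_ord1 !ffunE].
by move=> K _; apply/ffunP => k; rewrite ffunE (ord1 k).
Qed.

Lemma near_param (c : chart M) (p : M) (P : M -> Prop) : chart_dom c p ->
  (\forall q \near p, P q) -> \forall y \near coord c p, chart_image c y /\ P (param c y).
Proof.
move=> cp nP; have cx : chart_image c (coord c p) by exists p.
have cpar : \forall y \near coord c p, P (param c y).
  by apply: (param_continuous cx); rewrite coordK.
have imn := open_near (@open_chart_image _ _ M c) cx.
near=> y; split; [by near: y|by near: y].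
Unshelve. all: by end_near. Qed.

Lemma near_coord (c : chart M) (p : M) (P : E -> Prop) : chart_dom c p ->
  (\forall y \near coord c p, P y) -> \forall q \near p, chart_dom c q /\ P (coord c q).
Proof.
move=> cp nP.
have domn := open_near (@chart_dom_open _ _ M c) cp.
have Pn : \forall q \near p, P (coord c q) by exact: (Defs.coord_continuous cp).
near=> q; split; [by near: q|by near: q].
Unshelve. all: by end_near. Qed.

Lemma near_msolves (th w : coefs 1) (h h' : M -> R) p :
  (\forall q \near p, h q = h' q) -> msolves th w h p -> msolves th w h' p.
Proof.
move=> hh' sh c cp; apply: near_eq_solves (sh c cp).
by apply: filterS (near_param cp hh') => y [].
Qed.

(** Partial derivatives follow the chain rule and coefficients follow [form_compatible], so the
    equation persists. Only directional derivatives of the transition map enter; differentiability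
    in the chart c thus comes from the continuity of the partial derivatives, which is why the
    equation is assumed near p. *)
Lemma solves_chart_change (th w : coefs 1) (h : M -> R) c c' p :
  Omega th -> Omega w -> chart_dom c p -> chart_dom c' p ->
  (\forall q \near p, solves (form_coef th c') (form_coef w c') (h \o param c') (coord c' q)) ->
  solves (form_coef th c) (form_coef w c) (h \o param c) (coord c p).
Proof.
move=> Oth Ow cp c'p sh.
have cx : chart_image c (coord c p) by exists p.
have c'n : \forall q \near p, chart_dom c' q by exact: open_near (@chart_dom_open _ _ M c') c'p.
have near2 : \forall q \near p, [/\ chart_dom c' q, (\forall r \near q, chart_dom c' r) &
    solves (form_coef th c') (form_coef w c') (h \o param c') (coord c' q)].
  near=> q; have c'q : chart_dom c' q by near: q.
  by split => //; [exact: open_near (@chart_dom_open _ _ M c') c'q|near: q].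
have {}near2 := near_param cp near2.
have D y j : chart_image c y -> chart_dom c' (param c y) ->
    (\forall r \near param c y, chart_dom c' r) ->
    solves (form_coef th c') (form_coef w c') (h \o param c') (coord c' (param c y)) ->
    is_derive y (unitv R j) (h \o param c : E -> R^o)
      (form_coef th c j y * h (param c y) + form_coef w c j y).
  move=> cy c'y c'ny [dh Dh]; have [cpy yE] := chart_imageP cy.
  have ty : (coord c @` (chart_dom c `&` chart_dom c')) y by exists (param c y).
  have dphi : derivable (coord c' \o param c) y (unitv R j).
    exact: Cm_on_derivable (transition_smooth c c' 1%N) ty.
  have eqn : \forall z \near y, ((h \o param c') \o (coord c' \o param c)) z = (h \o param c) z.
    have := near_param cpy c'ny; rewrite yE; apply: filterS => z [_ c'z] /=.
    by rewrite coordK.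
  apply: near_eq_is_derive eqn _; apply: is_derive_eq; first exact: is_derive_comp.
  rewrite diff_unitv //.
  rewrite (form_coef_compatible j Oth cy c'y) (form_coef_compatible j Ow cy c'y).
  rewrite mulr_suml -big_split /=; apply: eq_bigr => k _.
  by rewrite Dh /= coordK // mulrDr mulrA.
have hc : {for coord c p, continuous (h \o param c : E -> R^o)}.
  have [_ [c'x c'nx [/differentiable_continuous ch _]]] := nbhs_singleton near2.
  have cphi : {for coord c p, continuous (coord c' \o param c)}.
    have tx : (coord c @` (chart_dom c `&` chart_dom c')) (coord c p) by exists p.
    exact: Cm_on_continuous (transition_smooth c c' 0%N) tx.
  have eqn : \forall z \near coord c p, (h \o param c) z = ((h \o param c') \o (coord c' \o param c)) z.
    by apply: filterS near2 => z [_ [c'z _ _]] /=; rewrite coordK.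
  have cc := continuous_comp cphi ch.
  rewrite /prop_for /continuous_at (nbhs_singleton eqn); apply: cvg_trans cc.
  by apply: (@near_eq_cvg _ _ (nbhs (coord c p))); apply: filterS eqn => z ->.
have Dn i : \forall y \near coord c p, is_derive y (unitv R i) (h \o param c : E -> R^o)
      (form_coef th c i y * h (param c y) + form_coef w c i y).
  by apply: filterS near2 => y [cy [c'y c'ny sy]]; exact: D.
split; last first.
  by move=> i; have [_ ->] := nbhs_singleton (Dn i).
apply: differentiable_of_partials => i.
  by apply: filterS (Dn i) => y [].
have [_ Dx] := nbhs_singleton (Dn i).
suff : 'D_(unitv R i) (h \o param c : E -> R^o) y @[y --> coord c p] -->
  form_coef th c i (coord c p) * h (param c (coord c p)) + form_coef w c i (coord c p).
  by rewrite -Dx.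
have cth : {for coord c p, continuous (form_coef th c i : E -> R^o)}.
  exact: Cm_on_continuous (form_smooth Oth c _ 0%N) cx.
have cw : {for coord c p, continuous (form_coef w c i : E -> R^o)}.
  exact: Cm_on_continuous (form_smooth Ow c _ 0%N) cx.
apply: cvg_trans (cvgD (cvgM cth hc) cw); apply: (@near_eq_cvg _ _ (nbhs (coord c p))).
by apply: filterS (Dn i) => y [_ ->].
Unshelve. all: by end_near. Qed.

End one_forms.

(** * The local system of a closed form and a twisted cocycle *)

Section twisted_system.
Context (R : realType) (n : nat) (M : smoothManifold R n).
Notation E := 'rV[R]_n.
Notation coefs k := (chart M -> {ffun 'I_k -> 'I_n} -> 'rV[R]_n -> R).
Variables th w : coefs 1.
Hypotheses (th_closed : closed_forms th) (w_cocycle : cocycles (twisted_d th) w).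

Lemma twisted_poincare_chart (c : chart M) a (r : R) : 0 < r ->
  (forall y, ball a r y -> chart_image c y) ->
  exists2 s : R, 0 < s <= r &
    (exists F, forall x, ball a s x -> solves (fun _ => cst 0) (form_coef th c) F x) /\
    forall y (v : R), ball a s y ->
      exists2 h, h y = v & forall x, ball a s x -> solves (form_coef th c) (form_coef w c) h x.
Proof.
move=> r0 rc; have [Oth dth] := th_closed; have [Ow dw] := w_cocycle.
have oc := @open_chart_image _ _ M c.
apply: twisted_poincare => //.
- by move=> i x /rc; apply: smooth_differentiable => //; exact: form_smooth.
- by move=> i x /rc; apply: smooth_differentiable => //; exact: form_smooth.
- by move=> i j x /rc; apply: smooth_derive_continuous; exact: form_smooth.
- by move=> i j x /rc; apply: smooth_derive_continuous; exact: form_smooth.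
- move=> i j x /rc cx; apply/eqP; rewrite -subr_eq0 -ext_d_index2 //; apply/eqP.
  by rewrite dth.
- move=> i j x /rc cx; apply/eqP; rewrite -subr_eq0 -ext_d_index2 // -wedge1_index2.
  by apply/eqP; have := congr1 (fun u => u c (index2 i j) x) dw.
Qed.

Lemma open_chart_ball (c : chart M) (a : E) (s : R) :
  open [set p | chart_dom c p /\ ball a s (coord c p)].
Proof.
rewrite openE => p [cp ps]; apply: near_coord => //.
exact: open_near (@ball_open _ _ a s) ps.
Qed.

(** The open sets are coordinate balls, whose points are joined by segments. For [separation], two
    solutions on a ball that agree at one point agree on all of it, by [solves_eq]. *)
Lemma msolves_local_system : local_system (msolves th w).
Proof.
have [Oth _] := th_closed; have [Ow _] := w_cocycle.
split=> [p|p h h' sh sh'].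
- have [c cp] := chart_cover p.
  have cx : chart_image c (coord c p) by exists p.
  have /nbhs_ballP[r /= r0 rc] := open_near (@open_chart_image _ _ M c) cx.
  have [s /andP[s0 sr] [_ sol]] := twisted_poincare_chart r0 rc.
  have sc y : ball (coord c p) s y -> chart_image c y by move=> /(le_ball sr)/rc.
  exists [set q | chart_dom c q /\ ball (coord c p) s (coord c q)]; split.
  + exact: open_chart_ball.
  + by split => //; exact: ballxx.
  + move=> q q' [cq qs] [cq' qs'].
    have seg t : 0 <= t <= 1 -> ball (coord c p) s (coord c q + t *: (coord c q' - coord c q)).
      move=> /andP[t0 t1]; move: qs qs'; rewrite -!ball_normE /= => qs qs'.
      rewrite (_ : _ - _ = (1 - t) *: (coord c p - coord c q) + t *: (coord c p - coord c q')).
        apply: le_lt_trans (ler_normD _ _) _; rewrite !normrZ (ger0_norm t0).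
        rewrite ger0_norm; last by rewrite subr_ge0.
        by have [AB|/ltW AB] := leP `|coord c p - coord c q| `|coord c p - coord c q'|; nra.
      by apply/rowP => k; rewrite !mxE; ring.
    exists (fun t => param c (coord c q + t *: (coord c q' - coord c q))); split.
    * apply: (@within_comp _ _ _ _ (ball (coord c p) s)
        (fun t : R => coord c q + t *: (coord c q' - coord c q)) (param c)).
      - by apply: continuous_subspaceT; exact: continuous_line.
      - by move=> _ [t t01 <-]; apply: seg; move: t01; rewrite /= in_itv.
      - by apply: continuous_in_subspaceT => y /set_mem ys; apply: param_continuous; exact: sc.
    * by rewrite scale0r addr0 coordK.
    * by rewrite scale1r subrKC coordK.
    * move=> t t01; have ys := seg t t01; have [cy yE] := chart_imageP (sc _ ys).
      by split => //=; rewrite yE.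
  + move=> q v [cq qs]; have [g gq gs] := sol (coord c q) v qs.
    exists (g \o coord c) => //= q' [cq' qs'] c' c'q'.
    apply: (solves_chart_change Oth Ow c'q' cq').
    have oU := @open_chart_ball c (coord c p) s.
    have qU : [set p0 | chart_dom c p0 /\ ball (coord c p) s (coord c p0)] q' by [].
    apply: filterS (open_near oU qU) => r' [cr rs].
    apply: near_eq_solves (gs _ rs).
    apply: filterS (open_near (@ball_open _ _ _ _) rs) => y ys /=.
    by have [_ ->] := chart_imageP (sc _ ys).
- have [c cp] := chart_cover p.
  have both : \forall q \near p, msolves th w h q /\ msolves th w h' q.
    by apply: filterS2 sh sh'.
  have /nbhs_ballP[r /= r0 rc] := near_param cp both.
  have [s /andP[s0 sr] [[F Fs] _]] := twisted_poincare_chart r0 (fun y ys => (rc y ys).1).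
  have sB y : ball (coord c p) s y -> ball (coord c p) r y by exact: le_ball.
  have hs y : ball (coord c p) s y -> solves (form_coef th c) (form_coef w c) (h \o param c) y.
    move=> /sB/rc[cy [sy _]]; have [cpy yE] := chart_imageP cy.
    by have := sy c cpy; rewrite yE.
  have hs' y : ball (coord c p) s y -> solves (form_coef th c) (form_coef w c) (h' \o param c) y.
    move=> /sB/rc[cy [_ sy]]; have [cpy yE] := chart_imageP cy.
    by have := sy c cpy; rewrite yE.
  have ps : ball (coord c p) s (coord c p) by exact: ballxx.
  have oU := @open_chart_ball c (coord c p) s.
  have pU : [set q | chart_dom c q /\ ball (coord c p) s (coord c q)] p by [].
  apply: filterS (open_near oU pU) => q [cq qs].
  have e1 := solves_eq Fs hs hs' qs ps; have e2 := solves_eq Fs hs hs' ps qs.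
  by rewrite /= !coordK // in e1 e2.
Qed.

(* A global solution is smooth because its partial derivatives are given by the
   equation; its coefficients in the charts form a 0-form. *)
Lemma msolves_coboundary (h : M -> R) : (forall p, msolves th w h p) ->
  coboundaries (twisted_d th) w.
Proof.
move=> hs; have [Oth _] := th_closed; have [Ow _] := w_cocycle.
pose u : coefs 0 := fun c J x => if x \in chart_image c then h (param c x) else 0.
have uE c J x : chart_image c x -> u c J x = h (param c x) by move=> cx; rewrite /u mem_set.
have us c x : chart_image c x -> solves (form_coef th c) (form_coef w c) (h \o param c) x.
  by move=> cx; have [cpx xE] := chart_imageP cx; have := hs _ c cpx; rewrite xE.
have oc c := @open_chart_image _ _ M c.
exists u.
  split.
  - move=> c J m; apply: (@eq_Cm_on _ _ _ _ (h \o param c)) => //.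
      by move=> x cx; rewrite uE.
    have : smooth_on (chart_image c) (h \o param c : E -> R^o).
      by apply: solves_smooth (us c) => // i; exact: form_smooth.
    exact.
  - by move=> c J x ncx; rewrite /u; case: ifPn => // /set_mem.
  - move=> c J s x; have -> : s = 1%g by apply/permP => -[].
    by rewrite odd_perm1 expr0 mul1r.
  - move=> c c' J x cx c'x.
    have cx' : chart_image c' (coord c' (param c x)) by exists (param c x).
    rewrite uE // (big_pred1 [ffun i : 'I_0 => J i]) => [|K].
      by rewrite big_ord0 mul1r uE // coordK.
    by apply/esym/eqP/ffunP => -[].
apply/funext => c; apply/funext => J; apply/funext => x.
have JE : J = [ffun=> J ord0] by apply/ffunP => k; rewrite ffunE (ord1 k).
rewrite /twisted_d !fctE /ext_d /wedge1 !big_ord1 !expr0 !mul1r.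
have [cx|ncx] := pselect (chart_image c x); last first.
  rewrite (form_out Ow) // (form_out Oth) // mul0r subr0.
  by case: ifPn => // /set_mem.
rewrite mem_set // uE //.
have -> : 'D_(unitv R (J ord0)) (u c (omit J ord0) : E -> R^o) x =
    'D_(unitv R (J ord0)) (h \o param c : E -> R^o) x.
  by apply: near_eq_derive; apply: filterS (open_near (oc c) cx) => y; exact: uE.
by have [_ ->] := us c x cx; rewrite /form_coef -JE /= addrC addKr.
Qed.

Lemma coboundary_of_fixed_point (x0 : M) (v0 : R) : connected [set: M] ->
  (forall f : loop R x0, transport (msolves th w) f v0 = v0) ->
  coboundaries (twisted_d th) w.
Proof.
move=> cM fix0; have [h hP] := global_solution msolves_local_system cM fix0.
apply: (@msolves_coboundary h) => p; have [k sk hk] := hP p.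
apply: near_msolves (nbhs_singleton sk); by apply: filterS hk => q ->.
Qed.

End twisted_system.

(** * Periods and monodromy *)

(** Lifts to different local systems along the same H combine pointwise, which expresses one
    transport through others. *)
Lemma is_lift_op (R : realType) (T Z : topologicalType) (L L' L'' : (T -> R) -> T -> Prop)
    (op : R -> R -> R) (B : set Z) (H : Z -> T) (K K' : Z -> R) :
  (forall h h' p, L h p -> L' h' p -> L'' (fun q => op (h q) (h' q)) p) ->
  is_lift L B H K -> is_lift L' B H K' -> is_lift L'' B H (fun z => op (K z) (K' z)).
Proof.
move=> LL lK lK' z Bz; have [h Lh Kh] := lK z Bz; have [h' Lh' Kh'] := lK' z Bz.
exists (fun q => op (h q) (h' q)).
  by apply: filterS2 Lh Lh' => p; exact: LL.
by apply: filterS2 Kh Kh' => y Kh Kh' By; rewrite Kh // Kh'.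
Qed.

Section periods.
Context (R : realType) (n : nat) (M : smoothManifold R n).
Notation E := 'rV[R]_n.
Notation coefs k := (chart M -> {ffun 'I_k -> 'I_n} -> 'rV[R]_n -> R).
Implicit Types (th w : coefs 1).

(** The integral of th along f, as the increment of a primitive of th continued along f. *)
Definition period th (f : R -> M) : R := transport (msolves (0 : coefs 1) th) f 0.

Lemma twisted_d_0 th k : twisted_d th (0 : coefs k) = 0.
Proof.
have := @twisted_d_lin _ _ M th k (-1) 0 0 (Omega0 M k) (Omega0 M k).
have -> : lin (-1) 0 0 = 0 :> coefs k.
  by apply/funext => c; apply/funext => J; apply/funext => x; rewrite /lin mulr0 addr0.
move=> ->; apply/funext => c; apply/funext => J; apply/funext => x.
by rewrite /lin mulN1r addNr.
Qed.

Lemma closed_forms0 : closed_forms (0 : coefs 1).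
Proof. by split; [exact: Omega0|rewrite -twisted_d0 twisted_d_0]. Qed.

Lemma closed_cocycle0 th : closed_forms th -> cocycles (twisted_d (0 : coefs 1)) th.
Proof. by move=> [Oth dth]; split => //; rewrite twisted_d0. Qed.

Lemma closed_forms_lin (a : R) th th' : closed_forms th -> closed_forms th' ->
  closed_forms (lin a th th').
Proof.
move=> [Oth dth] [Oth' dth']; split; first exact: Omega_lin.
rewrite ext_d_lin // dth dth'.
by apply/funext => c; apply/funext => J; apply/funext => x; rewrite /lin mulr0 addr0.
Qed.

Lemma primitive_local_system th : closed_forms th -> local_system (msolves (0 : coefs 1) th).
Proof.
by move=> cth; apply: msolves_local_system closed_forms0 _; exact: closed_cocycle0.
Qed.

(** When dF = th, the multiples of e^F solve dh = h th, and adding one of them leaves w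
    unchanged. *)
Lemma msolves_addM_exp th w (v : R) h F p : msolves th w h p ->
  msolves (0 : coefs 1) th F p -> msolves th w (fun q => h q + v * expR (F q)) p.
Proof.
move=> sh sF c cp; have sFc : solves (fun _ => cst 0) (form_coef th c) (F \o param c) (coord c p).
  by apply: eq_solves (sF c cp).
have se : solves (form_coef th c) (fun i y => (-1) * (v * cst 0 y))
    (fun y => -1 * (v * (expR \o (F \o param c)) y)) (coord c p).
  exact: (solvesZ (-1) (solvesZ v (solves_exp sFc))).
have := solvesB (sh c cp) se => {se}; rewrite (_ : (fun y => _ - _) =
  (fun q => h q + v * expR (F q)) \o param c).
  by apply: eq_solves => i //=; rewrite mulr0 mulr0 subr0.
by apply/funext => y /=; rewrite mulN1r opprK.
Qed.

(** The lift from v is the lift from 0 plus v times the exponential of the continued primitive of th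
    that starts at 0. *)
Lemma transport_affine th w (f : R -> M) v : closed_forms th -> cocycles (twisted_d th) w ->
  is_path f -> transport (msolves th w) f v =
    transport (msolves th w) f 0 + v * expR (period th f).
Proof.
move=> cth cw pf; have sL := msolves_local_system cth cw.
have sP := primitive_local_system cth.
have [K lK K0] := path_lift sL 0 pf; have [P lP P0] := path_lift sP 0 pf.
have lKP := is_lift_op (op := fun s t => s + v * expR t) (@msolves_addM_exp th w v) lK lP.
rewrite (transport_lift sL pf lKP) ?K0 ?P0 ?expR0 ?mulr1 ?add0r //.
by rewrite (transport_lift sL pf lK K0) /period (transport_lift sP pf lP P0).
Qed.

Lemma msolves_sub th th' F F' p : msolves (0 : coefs 1) th F p ->
  msolves (0 : coefs 1) th' F' p ->
  msolves (0 : coefs 1) (lin (-1) th' th) (fun q => F q - F' q) p.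
Proof.
move=> sF sF' c cp; have := solvesB (sF c cp) (sF' c cp).
by apply: eq_solves => i //=; rewrite /form_coef /lin mulN1r addrC.
Qed.

Lemma periodB th th' f : closed_forms th -> closed_forms th' -> is_path f ->
  period (lin (-1) th' th) f = period th f - period th' f.
Proof.
move=> cth cth' pf.
have sP := primitive_local_system cth; have sP' := primitive_local_system cth'.
have sB := primitive_local_system (closed_forms_lin (-1) cth' cth).
have [P lP P0] := path_lift sP 0 pf; have [P' lP' P'0] := path_lift sP' 0 pf.
have lB := is_lift_op (op := fun s t => s - t) (@msolves_sub th th') lP lP'.
rewrite /period (transport_lift sP pf lP P0) (transport_lift sP' pf lP' P'0).
by rewrite (transport_lift sB pf lB) // P0 P'0 subrr.
Qed.

(** The zero form is the difference of itself with itself, so [periodB] applies. *)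
Lemma period0 f : is_path f -> period (0 : coefs 1) f = 0.
Proof.
move=> pf; rewrite -[RHS](subrr (period 0 f)) -periodB //; try exact: closed_forms0.
congr period; apply/funext => c; apply/funext => J; apply/funext => x.
by rewrite /lin mulr0 addr0.
Qed.

Lemma transport_primitive th f v : closed_forms th -> is_path f ->
  transport (msolves (0 : coefs 1) th) f v = period th f + v.
Proof.
move=> cth pf; rewrite (transport_affine _ closed_forms0) //; last exact: closed_cocycle0.
by rewrite period0 // expR0 mulr1.
Qed.

Lemma coh_class_eq (d : forall k, coefs k -> coefs k.+1) (u v : coefs 1) :
  (forall a (w w' : coefs 0), Omega w -> Omega w' -> d 0%N (lin a w w') = lin a (d 0%N w) (d 0%N w')) ->
  coboundaries d (lin (-1) v u) -> coh_class d u = coh_class d v.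
Proof.
move=> dlin [h Oh dh]; apply/seteqP; split => x [b [g Og <-] <-].
  exists (d 0%N (lin 1 h g)); first by exists (lin 1 h g) => //; exact: Omega_lin.
  rewrite dlin // dh; apply/funext => c; apply/funext => J; apply/funext => y.
  by rewrite !fctE /lin; ring.
exists (d 0%N (lin (-1) h g)); first by exists (lin (-1) h g) => //; exact: Omega_lin.
rewrite dlin // dh; apply/funext => c; apply/funext => J; apply/funext => y.
by rewrite !fctE /lin; ring.
Qed.

Lemma nontrivial_twisted th : nontrivial_cohomology (twisted_d th) 1 ->
  exists2 w : coefs 1, cocycles (twisted_d th) w & ~ coboundaries (twisted_d th) w.
Proof.
move=> [_ [w cw <-] wn]; exists w => // bw; apply: wn.
apply: coh_class_eq; first by move=> a u u'; exact: twisted_d_lin.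
rewrite (_ : lin (-1) 0 w = w) //.
by apply/funext => c; apply/funext => J; apply/funext => x; rewrite /lin mulr0 add0r.
Qed.

Section fundamental_group.
Variable (x0 : M).
Hypothesis M_connected : connected [set: M].
Local Notation pi := (pi1 R x0).

Lemma loop_path (f : loop R x0) : is_path f.
Proof. exact: loop_continuous. Qed.

Definition monodromy L (a : pi) (v : R) : R := transport L (repr a) v.

Lemma monodromy_pi L (f : loop R x0) v : local_system L ->
  monodromy L (\pi_pi f) v = transport L f v.
Proof.
move=> sL; apply: transport_homotopic => //; apply/pi1P; exact: reprK.
Qed.

(** The product of loops runs through its left factor first, so this is a right action. *)
Lemma monodromyM L (a b : pi) v : local_system L ->
  monodromy L (a * b)%g v = monodromy L b (monodromy L a v).
Proof.
move=> sL; rewrite [(a * b)%g]/(pi1_mul a b) /pi1_mul monodromy_pi //.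
by apply: (transport_cat sL); rewrite ?loop0 ?loop1 //; exact: loop_path.
Qed.

Lemma periodM th (a b : pi) : closed_forms th ->
  period th (repr (a * b)%g) = period th (repr a) + period th (repr b).
Proof.
move=> cth; have := @monodromyM _ a b 0 (primitive_local_system cth).
rewrite /monodromy -/(period th (repr (a * b)%g)) -/(period th (repr a)) => ->.
by rewrite transport_primitive //; [rewrite addrC|exact: loop_path].
Qed.

(** The translation parts form a crossed homomorphism: the composite affine map is evaluated at
    0. *)
Lemma cocycleM th w (a b : pi) : closed_forms th -> cocycles (twisted_d th) w ->
  monodromy (msolves th w) (a * b)%g 0 =
  monodromy (msolves th w) a 0 * expR (period th (repr b)) + monodromy (msolves th w) b 0.
Proof.
move=> cth cw; have sL := msolves_local_system cth cw.
by rewrite monodromyM // /monodromy transport_affine // 1?addrC //; exact: loop_path.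
Qed.

Lemma coboundary_of_monodromy th w v0 : closed_forms th -> cocycles (twisted_d th) w ->
  (forall a : pi, monodromy (msolves th w) a 0 + v0 * expR (period th (repr a)) = v0) ->
  coboundaries (twisted_d th) w.
Proof.
move=> cth cw fix0; apply: (@coboundary_of_fixed_point R n M th w cth cw x0 v0) => // f.
have sL := msolves_local_system cth cw.
rewrite -monodromy_pi // /monodromy transport_affine //; last exact: loop_path.
exact: fix0.
Qed.

(** With zero twist pi_1 acts by translations through the periods. The difference of two forms with
    equal periods acts trivially, so 0 is a fixed point and the difference has a global
    primitive. *)
Lemma deRham_class_eq th th' : closed_forms th -> closed_forms th' ->
  (forall a : pi, period th (repr a) = period th' (repr a)) ->
  deRham_class th = deRham_class th'.
Proof.
move=> cth cth' pE; apply: coh_class_eq; first by move=> a u u'; exact: ext_d_lin.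
have cB := closed_forms_lin (-1) cth' cth.
have [] : coboundaries (twisted_d (0 : coefs 1)) (lin (-1) th' th).
  apply: (@coboundary_of_monodromy _ _ 0); [exact: closed_forms0|exact: closed_cocycle0|].
  move=> a; rewrite mul0r addr0 -[LHS]/(period _ _) periodB //; last exact: loop_path.
  by rewrite pE subrr.
by move=> h Oh <-; exists h => //; rewrite twisted_d0.
Qed.

End fundamental_group.
End periods.

(** * Eigenvectors in Hom(G, R) *)

Lemma generated_sub (gT : groupType) (A S : set gT) : is_subgroup S -> A `<=` S ->
  generated A `<=` S.
Proof. by move=> sS AS; exact: smallest_sub. Qed.

Lemma sub_generated (gT : groupType) (A : set gT) : A `<=` generated A.
Proof. exact: sub_smallest. Qed.

Lemma generated_subgroup (gT : groupType) (A : set gT) : is_subgroup (generated A).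
Proof.
split.
- by move=> S [[S1 _ _] _].
- by move=> x y gx gy S SP; have [[_ SM _] _] := SP; apply: SM; [exact: gx|exact: gy].
- by move=> x gx S SP; have [[_ _ SV] _] := SP; apply: SV; exact: gx.
Qed.

Section characters.
Context (R : realType) (gT : groupType).
Local Notation G := (commutator_subgroup gT).

Lemma commutator_subgroupP : is_subgroup G.
Proof. exact: generated_subgroup. Qed.

Lemma commutator_in (x y : gT) : G [~ x, y]%g.
Proof. by apply: sub_generated; exists x, y. Qed.

(** This is the identity h ^ g = h [h, g]. *)
Lemma conjg_in (h g : gT) : G h -> G (h ^ g)%g.
Proof.
have [_ GM _] := commutator_subgroupP.
move=> Gh; rewrite -[(h ^ g)%g](mulVKg h); apply: GM => //; exact: commutator_in.
Qed.

Definition additive_hom (p : gT -> R) : Prop := forall a b, p (a * b)%g = p a + p b.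

(* f restricted to G is a joint eigenvector of the conjugation action on Hom(G, R), with
   eigenvalue e^(p g) at g. *)
Definition eigenhom (p f : gT -> R) : Prop :=
  [/\ forall a b, G a -> G b -> f (a * b)%g = f a + f b,
      forall h g, G h -> f (h ^ g)%g = expR (p g) * f h &
      exists2 h, G h & f h != 0].

Section additive_theory.
Variable p : gT -> R.
Hypothesis pM : additive_hom p.

Lemma additive1 : p 1%g = 0.
Proof. by have := pM 1%g 1%g; rewrite mulg1; lra. Qed.

Lemma additiveV a : p (a^-1)%g = - p a.
Proof. by have := pM (a^-1)%g a; rewrite mulVg additive1; lra. Qed.

Lemma additive_commutator h : G h -> p h = 0.
Proof.
apply: (@generated_sub _ _ [set h | p h = 0]).
  split => [|x y /= px py|x /= px]; first exact: additive1.
    by rewrite pM px py addr0.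
  by rewrite additiveV px oppr0.
by move=> _ [x [y ->]] /=; rewrite /commg /conjg !pM !additiveV; lra.
Qed.

(* The affine maps v |-> v e^(p a) + u a form an action of gT; its elements of G act as
   translations, and if these are all trivial the fixed point of any non-translation is
   fixed by everything. *)
Lemma eigenhom_of_cocycle (u : gT -> R) :
  (forall a b, u (a * b)%g = u a * expR (p b) + u b) ->
  (exists a, p a != 0) -> (forall v, exists a, u a + v * expR (p a) != v) ->
  eigenhom p u.
Proof.
move=> uM [g pg] nofix; have u1 : u 1%g = 0.
  by have := uM 1%g 1%g; rewrite mulg1 additive1 expR0; lra.
split.
- by move=> a b Ga Gb; rewrite uM (additive_commutator Gb) expR0 mulr1.
- move=> h a Gh; have := uM (a^-1)%g a; rewrite mulVg u1.
  rewrite conjgE mulgA !uM (additive_commutator Gh) expR0 mulr1; lra.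
apply: contrapT => u0; have {}u0 h : G h -> u h = 0.
  by move=> Gh; apply: contrapT => /eqP uh; apply: u0; exists h.
have e0 : 1 - expR (p g) != 0.
  by apply: contra pg => /eqP e; rewrite -(inj_eq (@expR_inj R)) expR0; apply/eqP; lra.
(* The candidate is the fixed point of g, whose linear part differs from 1. *)
have [a /eqP] := nofix (u g / (1 - expR (p g))); apply.
(* As g a = a g [g, a] and the commutator acts trivially, g and a commute as affine maps, so a fixes
   the unique fixed point of g. *)
have : u (g * a)%g = u (a * g * [~ g, a])%g.
  by congr u; rewrite /commg /conjg mulgA mulgK mulKVg.
rewrite 3!uM (additive_commutator (commutator_in g a)) (u0 _ (commutator_in g a)).
rewrite expR0 mulr1 addr0 => e.
apply: (mulIf e0); rewrite mulrDl mulrAC divfK //.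
by move: e; lra.
Qed.

End additive_theory.

Lemma eigenhom1 p f : eigenhom p f -> f 1%g = 0.
Proof.
move=> [fM _ _]; have [G1 _ _] := commutator_subgroupP.
by have := fM _ _ G1 G1; rewrite mulg1; lra.
Qed.

Lemma eigenhomV p f h : eigenhom p f -> G h -> f (h^-1)%g = - f h.
Proof.
move=> ef Gh; have [_ _ GV] := commutator_subgroupP.
by have [fM _ _] := ef; have := fM _ _ (GV _ Gh) Gh; rewrite mulVg (eigenhom1 ef); lra.
Qed.

(* e^(p g) and its inverse e^(p g^-1) are both integers. *)
Lemma cyclic_eigenhom0 p f (a : gT) : additive_hom p -> eigenhom p f -> generated [set a] = G ->
  forall g, p g = 0.
Proof.
move=> pM ef aG; have [fM fJ [h Gh fh]] := ef.
have [G1 GM GV] := commutator_subgroupP.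
have Ga : G a by rewrite -aG; exact: sub_generated.
(* The values of f on G are integral multiples of f a. Among them is f (a ^ g) = e^(p g) f a, which
   makes e^(p g) an integer. *)
have int_f x : G x -> exists k : int, f x = k%:~R * f a.
  move=> Gx; suff [] : (G `&` [set x | exists k : int, f x = k%:~R * f a]) x by [].
  move: Gx; rewrite -{1}aG; apply: generated_sub; last first.
    by move=> _ ->; split => //; exists 1; rewrite mul1r.
  split.
  - by split => //; exists 0; rewrite mul0r (eigenhom1 ef).
  - move=> y z [Gy [k fy]] [Gz [l fz]]; split; first exact: GM.
    by exists (k + l); rewrite fM // fy fz intrD mulrDl.
  - move=> y [Gy [k fy]]; split; first exact: GV.
    by exists (- k); rewrite (eigenhomV ef) // fy intrN mulNr.
have fa : f a != 0.
  by have [k fhk] := int_f h Gh; apply: contra fh => /eqP fa; rewrite fhk fa mulr0.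
have int_e g : exists k : int, expR (p g) = k%:~R.
  have [k e] := int_f _ (conjg_in g Ga); exists k; apply: (mulIf fa).
  by rewrite -fJ.
move=> g; apply/eqP; rewrite -(inj_eq (@expR_inj R)) expR0; have [k ek] := int_e g; have [l el] := int_e (g^-1)%g.
have kl : k * l = 1.
  apply: (@intr_inj R); rewrite intrM -ek -el -expRD additiveV // subrr expR0 //.
have k0 : 0 < k by rewrite -(ltr0z R) -ek expR_gt0.
have l0 : 0 < l by rewrite -(ltr0z R) -el expR_gt0.
rewrite ek; apply/eqP; have -> // : k = 1.
rewrite gtz0_ge1 in k0; rewrite gtz0_ge1 in l0.
by apply/le_anti; rewrite k0 -kl ler_peMr // (le_trans _ k0).
Qed.

(** Dedekind's argument, by induction on the number of nonzero coefficients: the relation at x g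
    minus e^(p_i g) times the relation at x loses the term i. So the coefficients c j with j
    different from i vanish, by a choice of g that separates p_j from p_i. *)
Lemma exp_characters_free m (p : 'I_m -> gT -> R) (c : 'I_m -> R) :
  (forall i, additive_hom (p i)) -> injective p ->
  (forall g, \sum_i c i * expR (p i g) = 0) -> forall i, c i = 0.
Proof.
move=> pM pI; have [k] := ubnP #|[pred i | c i != 0]|.
elim: k c => // k IH c; rewrite ltnS => ck c0 i; apply: contrapT => /eqP ci.
have cj j : j != i -> c j = 0.
  move=> ji; have /existsNP[g /eqP pg] : ~ (forall g, p j g = p i g).
    by move=> /funext /pI e; rewrite e eqxx in ji.
  have e_neq : expR (p j g) - expR (p i g) != 0.
    by rewrite subr_eq0; apply: contra pg => /eqP /expR_inj ->.
  suff /eqP : c j * (expR (p j g) - expR (p i g)) = 0.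
    by rewrite mulf_eq0 (negPf e_neq) orbF => /eqP.
  apply: (IH (fun j => c j * (expR (p j g) - expR (p i g)))) => [|x].
    apply: leq_trans ck; apply/proper_card/properP; split.
      by apply/fintype.subsetP => l; rewrite !inE; apply: contra => /eqP ->; rewrite mul0r.
    by exists i; rewrite inE // subrr mulr0 eqxx.
  rewrite (eq_bigr (fun j => c j * expR (p j (x * g)%g) - expR (p i g) * (c j * expR (p j x)))).
    by rewrite sumrB c0 -mulr_sumr c0 mulr0 subrr.
  by move=> l _; rewrite pM expRD; ring.
have := c0 1%g; rewrite (bigD1 i) //= big1 => [|j /cj ->]; last by rewrite mul0r.
by rewrite additive1 // expR0 mulr1 addr0 => ci0; rewrite ci0 eqxx in ci.
Qed.

(** If r < m, the rows of the matrix f_i(a_j) satisfy a relation, which extends from the generators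
    to G. Read at the conjugates of h, it relates the characters e^(p_i) with coefficients c_i
    f_i(h); these must vanish, although each f_i is nonzero somewhere on G. *)
Lemma eigenhom_bound m r (p f : 'I_m -> gT -> R) (a : 'I_r -> gT) :
  (forall i, additive_hom (p i)) -> injective p -> (forall i, eigenhom (p i) (f i)) ->
  generated (range a) = G -> (m <= r)%N.
Proof.
move=> pM pI ef aG; rewrite leqNgt; apply/negP => rm.
pose A : 'M[R]_(m, r) := \matrix_(i, j) f i (a j).
have : ~~ row_free A.
  by rewrite /row_free neq_ltn (leq_ltn_trans (rank_leq_col A) rm).
rewrite -kermx_eq0 => /rowV0Pn[c /sub_kermxP cA c0].
have fG0 h : G h -> \sum_i c 0 i * f i h = 0.
  move=> Gh; suff [] : (G `&` [set h | \sum_i c 0 i * f i h = 0]) h by [].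
  have [G1 GM GV] := commutator_subgroupP.
  move: Gh; rewrite -{1}aG; apply: generated_sub; last first.
    move=> _ [j _ <-]; split; first by rewrite -aG; apply: sub_generated; exists j.
    have := congr1 (fun B : 'rV_r => B 0 j) cA; rewrite !mxE /= => cAj.
    by rewrite -[RHS]cAj; apply: eq_bigr => i _; rewrite mxE.
  split.
  - by split=> //=; rewrite big1 // => i _; rewrite (eigenhom1 (ef i)) mulr0.
  - move=> x y [Gx /= x0] [Gy /= y0]; split; first exact: GM.
    rewrite /= (eq_bigr (fun i => c 0 i * f i x + c 0 i * f i y)) => [|i _].
      by rewrite big_split /= x0 y0 addr0.
    by have [fM _ _] := ef i; rewrite fM // mulrDr.
  - move=> x [Gx /= x0]; split; first exact: GV.
    rewrite /= (eq_bigr (fun i => - (c 0 i * f i x))) => [|i _].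
      by rewrite sumrN x0 oppr0.
    by rewrite (eigenhomV (ef i)) // mulrN.
have cf h : G h -> forall i, c 0 i * f i h = 0.
  move=> Gh; apply: (exp_characters_free pM pI) => g.
  have cg := fG0 _ (conjg_in g Gh); rewrite -[RHS]cg; apply: eq_bigr => i _.
  by have [_ fJ _] := ef i; rewrite fJ // -mulrA [f i h * _]mulrC.
move/negP: c0; apply; apply/eqP/rowP => i; rewrite mxE.
have [_ _ [h Gh fh]] := ef i; have /eqP := cf h Gh i.
by rewrite mulf_eq0 (negPf fh) orbF => /eqP.
Qed.

End characters.

(** * Counting classes *)

Lemma card_eq_II_enum (T : Type) (A : set T) r : A #= `I_r ->
  exists2 a : 'I_r -> T, injective a & range a = A.
Proof.
move=> /pcard_eqP[e].
have sur (i : 'I_r) : exists x, A x /\ e x = i.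
  by have [x Ax ex] := @surj _ _ _ _ e _ (ltn_ord i : `I_r i); exists x.
have [a aP] := choice sur; exists a.
  by move=> i j ij; apply: val_inj; rewrite /= -(aP i).2 -(aP j).2 ij.
apply/seteqP; split => [_ [i _ <-]|x Ax]; first exact: (aP i).1.
have ex : (e x < r)%N by exact: (@funS _ _ _ _ e).
exists (Ordinal ex) => //; have [Aa ea] := aP (Ordinal ex).
by apply: (@inj _ _ _ e); rewrite ?inE.
Qed.

(** This reduces counting to finite injective families, the setting of [eigenhom_bound]. Finiteness
    comes along, since an infinite set contains r + 1 points. *)
Lemma card_le_II_inj (T : Type) (A : set T) r :
  (forall m (C : 'I_m -> T), injective C -> (forall i, A (C i)) -> (m <= r)%N) ->
  A #<= `I_r.
Proof.
move=> Ar; have fA : finite_set A.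
  apply: contrapT => /infiniteP nA.
  have : `I_r.+1 #<= A by apply: card_le_trans nA; exact: card_leT.
  move=> /card_subP[B /card_eq_II_enum[a aI aB] BA].
  suff : (r.+1 <= r)%N by rewrite ltnn.
  by apply: (Ar _ a aI) => i; apply: BA; rewrite -aB; exists i.
have /finite_setP[m Am] := fA; have [a aI aA] := card_eq_II_enum Am.
rewrite (card_le_eql Am) card_le_II.
by apply: (Ar _ a aI) => i; rewrite -aA; exists i.
Qed.

(** The inequality r + 1 <= r ^ s for a possibly infinite s: c is sent to a nonconstant function,
    the other elements to distinct constant functions. *)
Lemma card_le_functions (T X Y : Type) (A : set T) (c : T) r :
  (1 < r)%N -> A `\ c #<= `I_r -> [set: X] #= `I_r -> (exists y y' : Y, y <> y') ->
  A #<= [set: Y -> X].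
Proof.
move=> r1 /pcard_leP[e] /card_eq_II_enum[x xI _] [y [y' yy']].
case: r r1 e x xI => // r r1 e x xI.
have xN0 : x (inord 0) <> x (inord 1).
  by move=> /xI /(congr1 val); rewrite /= !inordK.
pose phi C : Y -> X := if `[< C = c >] then fun z => if `[< z = y >] then x (inord 0) else x (inord 1)
  else cst (x (inord (e C))).
have phic : phi c y <> phi c y'.
  by rewrite /phi asboolT // asboolT // asboolF // => h; apply: yy'.
have phin C : C <> c -> phi C y = phi C y' by move=> Cc; rewrite /phi asboolF.
have phiI : {in A &, injective phi}.
  move=> C D; rewrite !inE => AC AD CD.
  have [Cc|Cc] := pselect (C = c); have [Dc|Dc] := pselect (D = c).
  - by rewrite Cc.
  - by exfalso; apply: phic; rewrite -Cc CD phin.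
  - by exfalso; apply: phic; rewrite -Dc -CD phin.
  - have eC : (e C < r.+1)%N by exact: (@funS _ _ _ _ e).
    have eD : (e D < r.+1)%N by exact: (@funS _ _ _ _ e).
    apply: (@inj _ _ _ e); rewrite ?inE //.
    have := congr1 (fun f => f y) CD; rewrite /phi asboolF // asboolF //.
    by move=> /xI /(congr1 val); rewrite /= !inordK.
have phiA := inj_card_eq phiI.
by rewrite -(card_le_eql phiA); exact: card_leT.
Qed.

Section twisted_classes.
Context (R : realType) (n : nat) (M : smoothManifold R n) (x0 : M).
Hypothesis M_connected : connected [set: M].
Notation coefs k := (chart M -> {ffun 'I_k -> 'I_n} -> 'rV[R]_n -> R).
Local Notation pi := (pi1 R x0).
Local Notation G := (commutator_subgroup pi).

(** As th is not exact, its period homomorphism is nonzero; as w is not exact, the affine action has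
    no fixed point. *)
Lemma twisted_class_eigenhom (C : set (coefs 1)) :
  (twisted_classes M `\ deRham_class 0) C ->
  exists th (f : pi -> R), [/\ closed_forms th, C = deRham_class th,
    additive_hom (fun a : pi => period th (repr a)) &
    eigenhom (fun a : pi => period th (repr a)) f].
Proof.
move=> [[th [cth /nontrivial_twisted[w cw nw]] <-] n0].
have pM : additive_hom (fun a : pi => period th (repr a)) by move=> a b; exact: periodM.
exists th, (fun a : pi => monodromy (msolves th w) a 0); split => //.
apply: eigenhom_of_cocycle => //.
- by move=> a b; exact: cocycleM.
- apply: contrapT => p0; apply: n0.
  apply: (deRham_class_eq (x0 := x0)) => //; first exact: closed_forms0.
  move=> a; rewrite period0; last exact: loop_path.
  by apply: contrapT => /eqP pa; apply: p0; exists a.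
- move=> v; apply: contrapT => fixv; apply: nw.
  apply: (@coboundary_of_monodromy _ _ _ x0 M_connected th w v) => // a.
  by apply: contrapT => /eqP av; apply: fixv; exists a.
Qed.

(** Distinct classes have distinct period homomorphisms, by [deRham_class_eq], as [eigenhom_bound]
    requires. *)
Lemma card_nonzero_twisted_classes r (a : 'I_r -> pi) : generated (range a) = G ->
  (twisted_classes M `\ deRham_class 0) #<= `I_r.
Proof.
move=> aG; apply: card_le_II_inj => m C CI CP.
have /choice[th thP] := fun i => twisted_class_eigenhom (CP i).
have {thP}/choice[f fP] := thP.
apply: (@eigenhom_bound R pi m r (fun i (a : pi) => period (th i) (repr a)) f a) => //.
- by move=> i; have [] := fP i.
- move=> i j ij; apply: CI; have [ci -> _ _] := fP i; have [cj -> _ _] := fP j.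
  by apply: (deRham_class_eq (x0 := x0)) => // b; exact: (congr1 (fun p => p b) ij).
- by move=> i; have [] := fP i.
Qed.

Lemma twisted_classes_cyclic (a : pi) : generated [set a] = G ->
  twisted_classes M `<=` [set deRham_class 0].
Proof.
move=> aG C EC; apply: contrapT => C0.
have [th [f [cth CE pM ef]]] := twisted_class_eigenhom (conj EC C0).
apply: C0; rewrite CE /=; apply: (deRham_class_eq (x0 := x0)) => //; first exact: closed_forms0.
move=> b; rewrite period0; last exact: loop_path.
exact: cyclic_eigenhom0 pM ef aG b.
Qed.

End twisted_classes.

Lemma centralizer_subgroup (gT : groupType) (c : gT) :
  is_subgroup [set x | (c * x = x * c)%g].
Proof.
split => [|y z /= cy cz|y /= cy]; first by rewrite /= mul1g mulg1.
  by rewrite /= mulgA cy -mulgA cz mulgA.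
by rewrite -[LHS](mulKg y) [(y * _)%g]mulgA -cy mulgK.
Qed.

(** Centralizers are subgroups, so commuting with the generator spreads to all elements; this is
    used first for g and then for an arbitrary x. *)
Lemma commutator_subgroup_cyclic (gT : groupType) (g : gT) :
  generated [set g] = [set: gT] -> commutator_subgroup gT = [set 1%g].
Proof.
move=> gg; have comm_gen c : (c * g = g * c)%g -> forall x, (c * x = x * c)%g.
  move=> cg x; have : [set: gT] x by [].
  rewrite -gg; apply: (generated_sub (centralizer_subgroup c)).
  by move=> _ ->.
have comm (x y : gT) : (x * y = y * x)%g by apply: (comm_gen x); exact/esym/(comm_gen g).
apply/seteqP; split => [|_ ->]; last by have [] := commutator_subgroupP gT.
apply: generated_sub => [|_ [x [y ->]]].
  by split => [//|x y -> ->|x ->]; rewrite /= ?mulg1 ?invg1.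
by rewrite /= /commg conjgE (comm x y) mulKg mulVg.
Qed.

Lemma generated1 (gT : groupType) : generated [set 1%g : gT] = [set 1%g].
Proof.
apply/seteqP; split; last exact: sub_generated.
apply: generated_sub => //; split => [//|x y -> ->|x ->]; by rewrite /= ?mulg1 ?invg1.
Qed.

Theorem corollary3p2 (R : realType) (n : nat) (M : smoothManifold R n) (x0 : M)
  (M_connected : connected [set: M])
  (G_fg : finitely_generated (commutator_subgroup (pi1 R x0))) :
  finite_set (twisted_classes M) /\
  (* #|Y -> X| = #|X| ^ #|Y|, also for infinite Y *)
  forall X Y : Type,
    has_rank (commutator_subgroup (pi1 R x0)) X ->
    has_rank [set: pi1 R x0] Y ->
    twisted_classes M #<= [set: Y -> X].
Proof.
have [B fB BG] := G_fg; split.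
  have /finite_setP[r /card_eq_II_enum[a _ aB]] := fB.
  have aG : generated (range a) = commutator_subgroup (pi1 R x0) by rewrite aB.
  have /card_le_finite := card_nonzero_twisted_classes M_connected aG.
  move=> /(_ (finite_II r)) fE.
  apply: (@sub_finite_set _ _ ((twisted_classes M `\ deRham_class 0) `|` [set deRham_class 0])).
    by move=> C EC; have [->|nC] := pselect (C = deRham_class 0); [right|left].
  by rewrite finite_setU; split => //; exact: finite_set1.
move=> X Y [A [[[a0 Aa0] AG] AX] Amin] [A' [[[g A'g] A'pi] A'Y] _].
(* The unit is added to B because a generating set competing in [has_rank] has to be nonempty. *)
have fA : finite_set A.
  apply: (@card_le_finite _ _ _ (1%g |` B)); last by rewrite finite_setU; split => //; exact: finite_set1.
  apply: Amin; split; first by exists 1%g; left.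
  rewrite -BG; apply/seteqP; split.
    apply: generated_sub; first exact: generated_subgroup.
    move=> x [->|Bx]; last exact: sub_generated.
    by have [] := generated_subgroup B.
  by apply: generated_sub; [exact: generated_subgroup|move=> x Bx; apply: sub_generated; right].
have /finite_setP[r Ar] := fA; have [a aI aA] := card_eq_II_enum Ar.
have Xr : [set: X] #= `I_r by rewrite -(card_eql AX).
(* A is nonempty, so r <= 1 leaves a single generator. Then only the zero class can occur, and
   [Y -> X] is inhabited because X is. *)
have [r1|r1] := leqP r 1%N.
  have AE : A = [set a0].
    apply/seteqP; split => [x Ax|_ -> //].
    move: Ax Aa0; rewrite -aA => -[i _ <-] [j _ <-]; congr a; apply: val_inj => /=.
    move: (leq_trans (ltn_ord i) r1) (leq_trans (ltn_ord j) r1).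
    by rewrite !ltnS !leqn0 => /eqP -> /eqP ->.
  have EC := @twisted_classes_cyclic R n M x0 M_connected a0; rewrite -AE in EC.
  apply: card_le_trans (subset_card_le (EC AG)) _.
  have [x _ _] := card_eq_II_enum Xr.
  have [i _ _] : range a a0 by rewrite aA.
  by rewrite (card_le_eql (eq_card1 _ (cst (x i) : Y -> X))); exact: card_leT.
have aG : generated (range a) = commutator_subgroup (pi1 R x0) by rewrite aA.
apply: (card_le_functions r1 (card_nonzero_twisted_classes M_connected aG) Xr).
(* Without two distinct elements in Y the group pi_1 would be cyclic and G trivial, generated by the
   unit alone, against r > 1. *)
apply: contrapT => Y1.
have A'1 : A' = [set g].
  have [[y _]|noY] := pselect (exists y : Y, True); last first.
    have Y0 : [set: Y] = set0.
      by apply/seteqP; split => // y _; apply: noY; exists y.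
    by move: A'Y; rewrite Y0 card_eq0 => /eqP A'0; rewrite A'0 in A'g.
  have YE : [set: Y] = [set y].
    by apply/seteqP; split => // z _; apply: contrapT => zy; apply: Y1; exists z, y.
  have A'I : A' #= `I_1 by rewrite (card_eql A'Y) YE card_set1.
  have [b _ bA'] := card_eq_II_enum A'I.
  apply/seteqP; split => [x|_ -> //].
  by move: A'g; rewrite -bA' => -[i _ <-] [j _ <-]; rewrite (ord1 i) (ord1 j).
rewrite A'1 in A'pi; have G1 := commutator_subgroup_cyclic A'pi.
have : A #<= [set 1%g : pi1 R x0].
  by apply: Amin; split; [exists 1%g|rewrite generated1 G1].
rewrite (card_le_eql Ar) (card_le_eqr card_set1) card_le_II.
by rewrite leqNgt r1.
Qed.
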